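(* Let $F\in\mathcal{H}(\Omega)'$, let $u^e\in\mathcal{H}(\Omega)$ be the solution of $B(u^e,v)=F(v)$ for all $v\in\mathcal{H}(\Omega)$, and let $u^G\in u^p+S_n(\Omega)$ be the abstract GFEM approximation, $B(u^G,v)=F(v)$ for all $v\in S_n(\Omega)$ (notation and assumptions in context). Put $$\Xi:=\big(\sqrt{\zeta\zeta^\ast}\,C_{\rm ad}\big)^{-1}\big(C_1/(2C_0C_b^2)\big)^{1/2}$$ and assume $d_{\mathtt{max}}\le1\le\max_{1\le i\le M}\|\widehat P_{i,0}\|$. If $$d_{\mathtt{max}}\le\big(4\sqrt2\,C_{\rm stab}\big)^{-1}\,\Xi,\qquad H^\ast_{\mathtt{max}}\le C_1\Big(2C_s\max_{1\le i\le M}\|\widehat P_{i,0}\|\Big)^{-1}\,\Xi,$$ then $$\|u^e-u^G\|_{\mathcal{H}(\Omega)}\le\frac{2C_b}{C_1}\inf_{\varphi\in u^p+S_n(\Omega)}\|u^e-\varphi\|_{\mathcal{H}(\Omega)}.$$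
   Context: **Abstract setting.** $\Omega\subset\mathbb{R}^d$ ($d=2,3$) is a bounded Lipschitz domain; $\mathcal{H}(\Omega)\subset\mathcal{L}(\Omega)\subset\mathcal{H}(\Omega)'$ are Hilbert spaces with continuous embeddings (dual with respect to the pivot space $\mathcal{L}(\Omega)$). $B$ is a sesquilinear form on $\mathcal{H}(\Omega)$ with $|B(u,v)|\le C_b\|u\|_{\mathcal{H}(\Omega)}\|v\|_{\mathcal{H}(\Omega)}$ and the Gårding-type inequality $C_1\|u\|^2_{\mathcal{H}(\Omega)}-C_0\|u\|^2_{\mathcal{L}(\Omega)}\le|B(u,u)|$, with $C_b,C_1,C_0>0$ (indefinite case). For every $F\in\mathcal{H}(\Omega)'$ the problems $B(u,v)=F(v)\ \forall v$ and (adjoint) $B(v,w)=F(v)\ \forall v$ are uniquely solvable in $\mathcal{H}(\Omega)$, and for $F\in\mathcal{L}(\Omega)$ one has $\|u\|_{\mathcal{H}(\Omega)}\le C_{\rm stab}\|F\|_{\mathcal{L}(\Omega)}$, $\|w\|_{\mathcal{H}(\Omega)}\le C^a_{\rm stab}\|F\|_{\mathcal{L}(\Omega)}$. For every subdomain $D\subset\Omega$ there are Hilbert spaces $\mathcal{H}_0(D)\subset\mathcal{H}(D)$ (continuous embedding; $\mathcal{H}_0(\Omega)=\mathcal{H}(\Omega)$) with: (a) for $D\subset D^{\ast}$ a linear ''zero extension'' $E_{D,D^\ast}:\mathcal{H}_0(D)\to\mathcal{H}_0(D^{\ast})$ with $\|E_{D,D^\ast}u\|_{\mathcal{H}_0(D^\ast)}=\|u\|_{\mathcal{H}_0(D)}$,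 in particular $\|u\|_{\mathcal{H}_0(D)}=\|E_{D,\Omega}u\|_{\mathcal{H}(\Omega)}$; (b) for $D\subset D^\ast$ a linear ''restriction'' $R_{D^\ast,D}:\mathcal{H}(D^\ast)\to\mathcal{H}(D)$, $u\mapsto u|_D$, with $\|u|_D\|_{\mathcal{H}(D)}\le\|u\|_{\mathcal{H}(D^\ast)}$, $R_{D^\ast,D}\circ E_{D,D^\ast}=\mathrm{id}$, and $R_{D^\ast,D}\circ R_{D^{\ast\ast},D^\ast}=R_{D^{\ast\ast},D}$; (c) bounded sesquilinear forms $B_D$ on $\mathcal{H}(D)$ with $B_\Omega=B$ and $B_D(u|_D,v)=B_{D^\ast}(u,E_{D,D^\ast}v)$ for $D\subset D^\ast$, $u\in\mathcal{H}(D^\ast)$, $v\in\mathcal{H}_0(D)$. Elements of $\mathcal{H}_0(D)$ are identified with their zero extensions. $\mathcal{L}(D)$ ($D\subset\Omega$) are associated local Hilbert spaces with $\mathcal{H}(D)\subset\mathcal{L}(D)$ and norm-nonincreasing restrictions. $\mathcal{H}_B(D)=\{u\in\mathcal{H}(D):B_D(u,v)=0\ \forall v\in\mathcal{H}_0(D)\}$. **Cover and partition of unity.** $\{\omega_i\}_{i=1}^M$ are overlapping subdomains with $\bigcup\omega_i=\Omega$, $\omega_i\subset\omega_i^\ast\subset\Omega$ are oversampling domains, and $P_i:\mathcal{H}(\omega_i)\to\mathcal{H}_0(\omega_i)$ are bounded linear operators with $u=\sum_iP_i(u|_{\omega_i})$ for all $u\in\mathcal{H}(\Omega)$. $\widehat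 P_{i,0}:\mathcal{H}_0(\omega_i^\ast)\to\mathcal{H}_0(\omega_i)$ is $\widehat P_{i,0}v=P_i(v|_{\omega_i})$, with operator norm $\|\widehat P_{i,0}\|$. $H^\ast_{\mathtt{max}}=\max_i\mathrm{diam}(\omega_i^\ast)$. **Local particular functions.** $\psi_i\in\mathcal{H}(\omega_i^\ast)$ satisfies $B_{\omega_i^\ast}(\psi_i,v)=F(v)$ for all $v\in\mathcal{H}_0(\omega_i^\ast)$ (existence assumed); $u_i^p=\psi_i|_{\omega_i}$. **Semi-inner products.** $B^+_{\omega_i^\ast}$ is a semi-inner product on $\mathcal{H}(\omega_i^\ast)$ and $\mathcal{K}_i\subset\mathcal{H}_B(\omega_i^\ast)$ a finite-dimensional space, $l_i=\dim\mathcal{K}_i$, with $B^+_{\omega_i^\ast}(v,w)=0\ \forall w\in\mathcal{H}(\omega_i^\ast)$ iff $v\in\mathcal{K}_i$; $(\mathcal{H}_B(\omega_i^\ast)/\mathcal{K}_i,B^+_{\omega_i^\ast})$ is a Hilbert space; $\|u\|_{B^+,\omega_i^\ast}=B^+_{\omega_i^\ast}(u,u)^{1/2}$. The operator $\widehat P_i:\mathcal{H}_B(\omega_i^\ast)\to\mathcal{H}_0(\omega_i)$, $\widehat P_iu=P_i(u|_{\omega_i})$, is injective on $\mathcal{K}_i$ and compact. $\mathcal{H}^0_B(\omega_i^\ast)=\{v\in\mathcal{H}_B(\omega_i^\ast):(\widehat P_iv,\widehat P_iw)_{\mathcal{H}_0(\omega_i)}=0\ \forall w\in\mathcal{K}_i\}$.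 **Local approximation spaces.** $(\lambda_{i,j},\phi_{i,j})$ is the $j$-th eigenpair (non-ascending order, $\lambda\in\mathbb{R}\cup\{+\infty\}$) of $(\widehat P_i\phi,\widehat P_iv)_{\mathcal{H}_0(\omega_i)}=\lambda B^+_{\omega_i^\ast}(\phi,v)$ for all $v\in\mathcal{H}_B(\omega_i^\ast)$; the eigenvalue $+\infty$ has eigenspace $\mathcal{K}_i$, and the later eigenpairs are those of the same problem on $\mathcal{H}_B^0(\omega_i^\ast)$. For $n_i>l_i$, $S_{n_i}(\omega_i)=\mathrm{span}\{\phi_{i,1}|_{\omega_i},\dots,\phi_{i,n_i}|_{\omega_i}\}$. Globally, $u^p=\sum_iP_iu_i^p$, $S_n(\Omega)=\{\sum_iP_i\phi_i:\phi_i\in S_{n_i}(\omega_i)\}$. **$n$-width.** $d_n(\omega_i,\omega_i^\ast)=\inf_{\dim Q=n,\,Q\subset\mathcal{H}_0(\omega_i)}\sup_{u\in\mathcal{H}_B^0(\omega_i^\ast)}\inf_{v\in Q}\|\widehat P_iu-v\|_{\mathcal{H}_0(\omega_i)}/\|u\|_{B^+,\omega_i^\ast}$, and $d_{\mathtt{max}}=\max_id_{n_i-l_i}(\omega_i,\omega_i^\ast)$. **Constants.** $\zeta$ (coloring constant): an integer such that $\{\omega_i\}$ can be partitioned into $\zeta$ classes such that for any two distinct subdomains $\omega_{j_1},\omega_{j_2}$ in the same class, $(u_1,u_2)_{\mathcal{H}(\Omega)}=0$ for all $u_1\in\mathcal{H}_0(\omega_{j_1})$, $u_2\in\mathcal{H}_0(\omega_{j_2})$.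 $\zeta^\ast$: the smallest positive integer with $\sum_i\|u|_{\omega_i^\ast}\|^2_{\mathcal{L}(\omega_i^\ast)}\le\zeta^\ast\|u\|^2_{\mathcal{L}(\Omega)}$ for all $u\in\mathcal{L}(\Omega)$ and $\sum_i\|v|_{\omega_i^\ast}\|^2_{B^+,\omega_i^\ast}\le\zeta^\ast\|v\|^2_{\mathcal{H}(\Omega)}$ for all $v\in\mathcal{H}(\Omega)$. **Adjoint assumption.** For $f\in\mathcal{L}(\Omega)$ let $\widehat S(f)\in\mathcal{H}(\Omega)$ solve $B(v,\widehat S(f))=(v,f)_{\mathcal{L}(\Omega)}$ for all $v\in\mathcal{H}(\Omega)$. For each $f\in\mathcal{L}(\Omega)$ there is $g\in\mathcal{L}(\Omega)$ such that $\hat u=\widehat S(f)$ or $\hat u=\overline{\widehat S(f)}$ solves $B(\hat u,v)=(g,v)_{\mathcal{L}(\Omega)}$ for all $v\in\mathcal{H}(\Omega)$, and $\|g\|_{\mathcal{L}(\Omega)}\le C_{\rm ad}\|f\|_{\mathcal{L}(\Omega)}$ with $C_{\rm ad}>0$ independent of $f$. **Local stability assumption.** There is $C_s>0$, depending only on the shapes of the $\omega_i^\ast$, such that if $H^\ast_{\mathtt{max}}\le(C_1/C_0)^{1/2}C_s^{-1}$, then for all $i$ and all $g_i\in\mathcal{L}(\omega_i^\ast)$ the problem: find $u_i\in\mathcal{H}_0(\omega_i^\ast)$ with $B_{\omega_i^\ast}(u_i,v)=(g_i,v)_{\mathcal{L}(\omega_i^\ast)}$ for all $v\in\mathcal{H}_0(\omega_i^\ast)$,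 is uniquely solvable with $\|u_i\|_{\mathcal{H}_0(\omega_i^\ast)}\le(C_sH^\ast_{\mathtt{max}}/C_1)\|g_i\|_{\mathcal{L}(\omega_i^\ast)}$.
   Formalization: Added, since the claim fails in general without the first two: C_1 ≤ 2C_b; and either Ŝ(f) itself solves the primal problem for every f (no conjugate needed) or S_n(Ω) is closed under complex conjugation. The forms B^+ are also taken to be bounded on H(ω_i^* ). *)

(* Defs.v *)
From HB Require Import structures.
From mathcomp Require Import all_boot all_order all_algebra.
From mathcomp Require Import complex.
From mathcomp Require Import all_classical all_reals all_analysis.

Set Implicit Arguments.
Unset Strict Implicit.
Unset Printing Implicit Defensive.

Import Order.TTheory GRing.Theory Num.Theory numFieldNormedType.Exports.
Local Open Scope classical_set_scope.
Local Open Scope ring_scope.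

(* Complex Hilbert spaces. Forms are linear in the first argument and
   conjugate-linear in the second one. *)
HB.mixin Record NormedModule_isHilbert (R : realType) H
    of CompleteNormedModule R[i] H := {
  inner : {dot H for (@Num.conj R[i])} ;
  inner_norm : forall u : H, inner u u = `|u| ^+ 2 }.

#[short(type="hilbertType")]
HB.structure Definition Hilbert (R : realType) :=
  {H of CompleteNormedModule R[i] H & NormedModule_isHilbert R H}.

Notation "{ 'sesq' U }" :=
  {bilinear U -> U -> _ | *%R & (@Num.conj _) \; *%R}
  (format "{ 'sesq'  U }") : ring_scope.
Notation "{ 'antifunctional' U }" :=
  {linear U -> _ | (@Num.conj _) \; *%R}
  (format "{ 'antifunctional'  U }") : ring_scope.

Section HilbertNotions.
Context {R : realType}.
Implicit Types U W : hilbertType R.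

(* The norm of a normed module over R[i] takes its values in R[i]. *)
Definition hnorm {U} (u : U) : R := complex.Re `|u|.

Definition cabs (z : R[i]) : R := complex.Re `|z|.

Definition bounded_map {U W} (T : U -> W) : Prop :=
  exists C : R, forall u, hnorm (T u) <= C * hnorm u.

Definition bounded_functional {U} (F : U -> R[i]) : Prop :=
  exists C : R, forall u, cabs (F u) <= C * hnorm u.

Definition bounded_form {U} (b : U -> U -> R[i]) : Prop :=
  exists C : R, forall u v, cabs (b u v) <= C * hnorm u * hnorm v.

Definition opnorm {U W} (T : U -> W) : R :=
  sup [set hnorm (T u) | u in [set u | hnorm u <= 1]].

Definition seminorm_of {U} (b : U -> U -> R[i]) (u : U) : R :=
  Num.sqrt (complex.Re (b u u)).

Definition span {U} (n : nat) (e : 'I_n -> U) : set U :=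
  [set \sum_(j < n) c j *: e j | c in [set: 'I_n -> R[i]]].

Definition lin_indep {U} (n : nat) (e : 'I_n -> U) : Prop :=
  forall c : 'I_n -> R[i], \sum_(j < n) c j *: e j = 0 -> forall j, c j = 0.

Definition has_dim {U} (n : nat) (Q : set U) : Prop :=
  exists e : 'I_n -> U, lin_indep e /\ Q = span e.

Definition dist {U} (x : U) (Q : set U) : R := inf [set hnorm (x - v) | v in Q].

(* The restriction of T to the subspace X is a compact operator. *)
Definition compact_on {U W} (X : set U) (T : U -> W) : Prop :=
  precompact (T @` [set u | X u /\ hnorm u <= 1]).

(* X modulo the kernel of the semi-inner product b is complete for b. *)
Definition complete_mod_kernel {U} (X : set U) (b : U -> U -> R[i]) : Prop :=
  forall u : nat -> U, (forall k, X (u k)) ->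
    (forall e : R, 0 < e -> exists N : nat, forall k m, (N <= k)%N -> (N <= m)%N ->
       seminorm_of b (u k - u m) < e) ->
  exists2 v, X v &
    forall e : R, 0 < e -> exists N : nat, forall k, (N <= k)%N ->
      seminorm_of b (u k - v) < e.

(* The n-width. For u = 0 the quotient is 0 / 0 = 0, which is harmless. *)
Definition nwidth {U W} (n : nat) (X : set U) (T : U -> W)
    (b : U -> U -> R[i]) : \bar R :=
  ereal_inf
    [set ereal_sup [set (dist (T u) Q / seminorm_of b u)%:E | u in X]
    | Q in has_dim n].

(* (lam, phi) is an eigenpair of (T phi, T v) = lam b(phi, v) for all v in X;
   the eigenvalue +oo has the eigenspace K. *)
Definition eigenpair {U W} (X K : set U) (T : U -> W) (b : U -> U -> R[i])
    (lam : \bar R) (phi : U) : Prop :=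
  [/\ phi != 0, X phi &
      match lam with
      | +oo%E => K phi
      | r%:E%E => forall v, X v -> inner (T phi) (T v) = r%:C%C * b phi v
      | -oo%E => False
      end].

(* The first n eigenpairs in non-ascending order and counted with their
   multiplicities: by the last clause no eigenpair that has to come before the
   j-th one is missing from the list. *)
Definition leading_eigenpairs {U W} (X K : set U) (T : U -> W)
    (b : U -> U -> R[i]) (n : nat) (lam : 'I_n -> \bar R) (phi : 'I_n -> U) :
    Prop :=
  [/\ forall j, eigenpair X K T b (lam j) (phi j),
      lin_indep phi,
      forall j k : 'I_n, (j <= k)%N -> (lam k <= lam j)%E &
      forall (j : 'I_n) mu psi, eigenpair X K T b mu psi -> (lam j < mu)%E ->
        exists c : 'I_n -> R[i], psi = \sum_(k < n | (k < j)%N) c k *: phi k].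

End HilbertNotions.

Section Geometry.
Context {R : realType} {d : nat}.
Implicit Types (D Om : set 'rV[R]_d) (x y : 'rV[R]_d).

(* The library norm of 'rV[R]_d is the sup norm; the Euclidean one is needed
   for diameters. *)
Definition edot x y : R := \sum_(k < d) x 0 k * y 0 k.
Definition enorm x : R := Num.sqrt (edot x x).

Definition diam D : R := sup [set enorm (p.1 - p.2) | p in D `*` D].

Definition is_domain D : Prop := [/\ open D, connected D & D !=set0].

Definition subdomain Om D : Prop := is_domain D /\ D `<=` Om.

(* Near each boundary point, Om is the strict epigraph, in a unit direction e,
   of a Lipschitz function of the coordinates orthogonal to e. *)
Definition bounded_lipschitz_domain Om : Prop :=
  [/\ is_domain Om, (exists r : R, forall x, Om x -> enorm x <= r) &
      forall x, (closure Om `\` Om) x ->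
        exists (e : 'rV[R]_d) (g : 'rV[R]_d -> R) (N : set 'rV[R]_d),
          [/\ enorm e = 1,
              forall y (t : R), g (y + t *: e) = g y,
              exists k : R, forall y z, `|g y - g z| <= k * enorm (y - z),
              nbhs x N &
              forall y, N y -> (Om y <-> g y < edot y e)]].

End Geometry.

(* The spaces H_0(D), H(D), L(D) and the forms B_D. The inclusions
   H_0(D) in H(D) in L(D) are the injections inc and emb, ext is the zero
   extension and res, resL are the restrictions. The families are total in D,
   but only subdomains of Om are constrained. *)
Record local_spaces (R : realType) (d : nat) (Om : set 'rV[R]_d) := LocalSpaces {
  sH0 : set 'rV[R]_d -> hilbertType R ;
  sH : set 'rV[R]_d -> hilbertType R ;
  sL : set 'rV[R]_d -> hilbertType R ;
  inc : forall D, {linear sH0 D -> sH D} ;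
  emb : forall D, {linear sH D -> sL D} ;
  ext : forall D D', {linear sH0 D -> sH0 D'} ;
  res : forall D' D, {linear sH D' -> sH D} ;
  resL : forall D' D, {linear sL D' -> sL D} ;
  form : forall D, {sesq (sH D)} ;
  inc_inj : forall D, subdomain Om D -> injective (inc D) ;
  inc_bounded : forall D, subdomain Om D -> bounded_map (inc D) ;
  emb_inj : forall D, subdomain Om D -> injective (emb D) ;
  emb_bounded : bounded_map (emb Om) ;
  (* L(Om) is embedded into H(Om)': g acts as v |-> (g, v) *)
  dual_inj : forall g : sL Om, (forall v, inner g (emb Om v) = 0) -> g = 0 ;
  (* H_0(Om) = H(Om) *)
  inc_full : forall u : sH Om, exists v : sH0 Om, inc Om v = u ;
  inc_isom : forall v : sH0 Om, hnorm (inc Om v) = hnorm v ;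
  ext_isom : forall D D', subdomain Om D -> subdomain Om D' -> D `<=` D' ->
    forall u : sH0 D, hnorm (ext D D' u) = hnorm u ;
  res_le : forall D D', subdomain Om D -> subdomain Om D' -> D `<=` D' ->
    forall u : sH D', hnorm (res D' D u) <= hnorm u ;
  res_ext : forall D D', subdomain Om D -> subdomain Om D' -> D `<=` D' ->
    forall u : sH0 D, res D' D (inc D' (ext D D' u)) = inc D u ;
  res_res : forall D D' D'', subdomain Om D -> subdomain Om D' ->
    subdomain Om D'' -> D `<=` D' -> D' `<=` D'' ->
    forall u : sH D'', res D' D (res D'' D' u) = res D'' D u ;
  form_bounded : forall D, subdomain Om D -> bounded_form (form D) ;
  form_res : forall D D', subdomain Om D -> subdomain Om D' -> D `<=` D' ->
    forall (u : sH D') (v : sH0 D),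
      form D (res D' D u) (inc D v) = form D' u (inc D' (ext D D' v)) ;
  resL_le : forall D D', subdomain Om D -> subdomain Om D' -> D `<=` D' ->
    forall g : sL D', hnorm (resL D' D g) <= hnorm g ;
  (* u|_D means the same in H and in L *)
  emb_res : forall D D', subdomain Om D -> subdomain Om D' -> D `<=` D' ->
    forall u : sH D', emb D (res D' D u) = resL D' D (emb D' u) ;
  (* pairing with v in H_0(D) is the same as pairing with its zero extension *)
  inner_res : forall D D', subdomain Om D -> subdomain Om D' -> D `<=` D' ->
    forall (g : sL D') (v : sH0 D),
      inner (resL D' D g) (emb D (inc D v)) =
      inner g (emb D' (inc D' (ext D D' v))) }.

Section GlobalProblem.
Context {R : realType} {d : nat} {Om : set 'rV[R]_d}.
Variable X : local_spaces Om.

Definition B : {sesq (sH X Om)} := form X Om.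

Definition zext (D : set 'rV[R]_d) (v : sH0 X D) : sH X Om :=
  inc X Om (ext X D Om v).

Definition continuity (Cb : R) : Prop :=
  forall u v, cabs (B u v) <= Cb * hnorm u * hnorm v.

Definition garding (C1 C0 : R) : Prop :=
  forall u, C1 * hnorm u ^+ 2 - C0 * hnorm (emb X Om u) ^+ 2 <= cabs (B u u).

Definition primal_solution (g : sL X Om) (u : sH X Om) : Prop :=
  forall v, B u v = inner g (emb X Om v).

(* w = S^(f) *)
Definition adjoint_solution (f : sL X Om) (w : sH X Om) : Prop :=
  forall v, B v w = inner (emb X Om v) f.

Definition unique_solvability : Prop :=
  (forall F : {antifunctional (sH X Om)}, bounded_functional F ->
     exists! u, forall v, B u v = F v) /\
  (forall F : {scalar (sH X Om)}, bounded_functional F ->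
     exists! w, forall v, B v w = F v).

Definition stability (Cstab Castab : R) : Prop :=
  forall f : sL X Om,
    (forall u, primal_solution f u -> hnorm u <= Cstab * hnorm f) /\
    (forall w, adjoint_solution f w -> hnorm w <= Castab * hnorm f).

(* The case of the adjoint assumption below in which no conjugation is needed. *)
Definition adjoint_is_primal (Cad : R) : Prop :=
  forall f w, adjoint_solution f w ->
    exists2 g, primal_solution g w & hnorm g <= Cad * hnorm f.

(* Complex conjugation on H(Om), a space of complex-valued functions. *)
Definition is_conjugation
    (cj : {linear (sH X Om) -> (sH X Om) | (@Num.conj R[i]) \; *:%R}) : Prop :=
  [/\ involutive cj,
      forall u, hnorm (cj u) = hnorm u &
      forall u, hnorm (emb X Om (cj u)) = hnorm (emb X Om u)].

Definition adjoint_assumption (cj : sH X Om -> sH X Om) (Cad : R) : Prop :=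
  forall f w, adjoint_solution f w ->
    exists2 g, primal_solution g w \/ primal_solution g (cj w) &
               hnorm g <= Cad * hnorm f.

(* H_B(D) *)
Definition HB (D : set 'rV[R]_d) : set (sH X D) :=
  [set u | forall v : sH0 X D, form X D u (inc X D v) = 0].

End GlobalProblem.

Arguments HB {R d Om} X D _ : rename.

Section GFEM.
Context {R : realType} {d : nat} {Om : set 'rV[R]_d}.
Variable X : local_spaces Om.
Variables (M : nat) (w ws : 'I_M -> set 'rV[R]_d).

Definition oversampled_cover : Prop :=
  [/\ forall i, subdomain Om (w i), forall i, subdomain Om (ws i),
      forall i, w i `<=` ws i & \bigcup_i w i = Om].

Definition Hmax : R := \big[Num.max/0]_(i < M) diam (ws i).

Variable P : forall i, {linear sH X (w i) -> sH0 X (w i)}.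

Definition partition_of_unity : Prop :=
  (forall i, bounded_map (P i)) /\
  (forall u : sH X Om, u = \sum_(i < M) zext (P i (res X Om (w i) u))).

(* P^_i, on the whole of H(ws i) *)
Definition Phat i (u : sH X (ws i)) : sH0 X (w i) :=
  P i (res X (ws i) (w i) u).

(* P^_{i,0} *)
Definition Phat0 i (v : sH0 X (ws i)) : sH0 X (w i) :=
  Phat (inc X (ws i) v).

Definition Pmax : R := \big[Num.max/0]_(i < M) opnorm (@Phat0 i).

Definition local_particular (F : sH X Om -> R[i])
    (psi : forall i, sH X (ws i)) : Prop :=
  forall i (v : sH0 X (ws i)), form X (ws i) (psi i) (inc X (ws i) v) = F (zext v).

(* u^p *)
Definition uparticular (psi : forall i, sH X (ws i)) : sH X Om :=
  \sum_(i < M) zext (P i (res X (ws i) (w i) (psi i))).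

Variable Bp : forall i, {hermitian_sym (sH X (ws i)) for (@Num.conj R[i])}.
Variables (K : forall i, set (sH X (ws i))) (l : 'I_M -> nat).
Arguments Bp : clear implicits.
Arguments K : clear implicits.

Definition semi_inner_products : Prop :=
  forall i,
  [/\ bounded_form (Bp i) /\ forall u, 0 <= Bp i u u,
      has_dim (l i) (K i) /\ K i `<=` HB X (ws i),
      forall v, HB X (ws i) v -> (forall u, Bp i v u = 0) <-> K i v &
      complete_mod_kernel (HB X (ws i)) (Bp i)].

Definition Phat_assumption : Prop :=
  forall i,
    (forall u v, K i u -> K i v -> Phat u = Phat v -> u = v) /\
    compact_on (HB X (ws i)) (@Phat i).

(* H_B^0(ws i) *)
Definition HB0 i : set (sH X (ws i)) :=
  [set v | HB X (ws i) v /\ forall w', K i w' -> inner (Phat v) (Phat w') = 0].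

Variable n : 'I_M -> nat.

Definition local_eigenpairs (lam : forall i, 'I_(n i) -> \bar R)
    (phi : forall i, 'I_(n i) -> sH X (ws i)) : Prop :=
  forall i,
    leading_eigenpairs (HB X (ws i)) (K i) (@Phat i) (Bp i) (lam i) (phi i).

(* S_{n_i}(w i) *)
Definition Sloc (phi : forall i, 'I_(n i) -> sH X (ws i)) i : set (sH X (w i)) :=
  span (fun j => res X (ws i) (w i) (phi i j)).

(* S_n(Om) *)
Definition Sn (phi : forall i, 'I_(n i) -> sH X (ws i)) : set (sH X Om) :=
  [set v | exists2 f : forall i, sH X (w i), (forall i, Sloc phi (f i)) &
           v = \sum_(i < M) zext (P i (f i))].

Definition dmax : \bar R :=
  \big[maxe/-oo%E]_(i < M) nwidth (n i - l i) (@HB0 i) (@Phat i) (Bp i).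

Definition coloring_constant (zeta : nat) : Prop :=
  exists color : 'I_M -> 'I_zeta, forall i j, i != j -> color i = color j ->
    forall (u1 : sH0 X (w i)) (u2 : sH0 X (w j)), inner (zext u1) (zext u2) = 0.

Definition overlap_bound (m : nat) : Prop :=
  [/\ (0 < m)%N,
      forall g : sL X Om,
        \sum_(i < M) hnorm (resL X Om (ws i) g) ^+ 2 <= m%:R * hnorm g ^+ 2 &
      forall v : sH X Om,
        \sum_(i < M) seminorm_of (Bp i) (res X Om (ws i) v) ^+ 2
          <= m%:R * hnorm v ^+ 2].

Definition overlap_constant (zetas : nat) : Prop :=
  overlap_bound zetas /\ forall m, overlap_bound m -> (zetas <= m)%N.

Definition local_solution i (g : sL X (ws i)) (u : sH0 X (ws i)) : Prop :=
  forall v : sH0 X (ws i),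
    form X (ws i) (inc X (ws i) u) (inc X (ws i) v) =
    inner g (emb X (ws i) (inc X (ws i) v)).

Definition local_stability (C1 C0 Cs : R) : Prop :=
  Hmax <= Num.sqrt (C1 / C0) * Cs^-1 ->
  forall i (g : sL X (ws i)),
    (exists! u, local_solution g u) /\
    (forall u, local_solution g u -> hnorm u <= Cs * Hmax / C1 * hnorm g).

End GFEM.

Arguments oversampled_cover {R d} Om {M} w ws.
Arguments partition_of_unity {R d Om} X {M w} P.
Arguments Pmax {R d Om} X {M w} ws P.
Arguments local_particular {R d Om} X {M} ws F psi.
Arguments uparticular {R d Om} X {M w ws} P psi.
Arguments semi_inner_products {R d Om} X {M ws} Bp K l.
Arguments Phat_assumption {R d Om} X {M w ws} P K.
Arguments local_eigenpairs {R d Om} X {M w ws} P Bp K {n} lam phi.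
Arguments Sn {R d Om} X {M w ws} P {n} phi _.
Arguments dmax {R d Om} X {M w ws} P Bp K l n.
Arguments coloring_constant {R d Om} X {M} w zeta.
Arguments overlap_constant {R d Om} X {M ws} Bp zetas.
Arguments local_stability {R d Om} X {M} ws C1 C0 Cs.

Definition Xi {R : realType} (zeta zetas : nat) (Cad C1 C0 Cb : R) : R :=
  (Num.sqrt (zeta%:R * zetas%:R) * Cad)^-1 * Num.sqrt (C1 / (2 * C0 * Cb ^+ 2)).

(* Main.v *)
Require Import Defs.
From mathcomp Require Import all_boot all_order all_algebra.
From mathcomp Require Import complex.
From mathcomp Require Import all_classical all_reals all_analysis.
From mathcomp Require Import ring lra.

Set Implicit Arguments.
Unset Strict Implicit.
Unset Printing Implicit Defensive.

Import Order.TTheory GRing.Theory Num.Theory numFieldNormedType.Exports.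
Local Open Scope classical_set_scope.
Local Open Scope ring_scope.

(** The proof is a duality argument of Schatz type. Write [e = ue - uG]. By
    Galerkin orthogonality [B e e = B e (ue - v)] for every [v] in [u^p + Sn], so
    the Garding inequality gives quasi-optimality with the constant [2 Cb / C1]
    as soon as [C0 |e|_L^2 <= C1 / 2 |e|^2]. Suppose that this fails. Let [z]
    solve the adjoint problem with right-hand side [e]. Then
    [|e|_L^2 = B e z = B e (z - v)] for every [v] in [Sn], and the contradiction
    comes from approximating [z] in [Sn] within [(C1 / (2 C0 Cb^2))^(1/2) |e|_L].
    By the adjoint assumption [z] or its conjugate solves a primal problem with
    right-hand side [g], and [|g| <= Cad |e|_L], so the point is to approximate
    solutions of primal problems ([gfem_approximation]).

    Such a solution [u] is split on each oversampling domain into a local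
    solution [u0] with zero boundary values and an element of [HB]
    ([local_error]). The first part is small because the domains are. The image
    of the second under [Phat] is approximated by the images of the leading
    eigenvectors with the accuracy of the width ([eigenspace_approximation]).
    The local errors are summed by the coloring ([hnorm_colored_sum]).

    The energy norm of [u0] is controlled by the overlap inequality at
    the price of a factor [zetas^(1/2)], which has to be compensated by the
    width. The smallness condition bounds the width by [Xi / Cstab] up to a
    constant, so a lower bound for [Cstab] is needed. It is the failure of
    [C0 |e|_L^2 <= C1 / 2 |e|^2] that provides it: the dual solution [z] must
    then be large, and [(zeta zetas)^(1/2) Xi <= Cstab] follows. The smallness
    of the domains required for local solvability follows from that in the
    hypotheses because [C1 <= 2 Cb], and because [Cad >= 1] unless [e = 0]
    ([adjoint_constant_lt1]).

    Optimality of the eigenvectors is proved variationally. On the complement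
    [W] of their span, orthogonal both for the semi-inner product [b] and for
    [(T ., T .)], the quotient [|T z|^2 / b z z] has a maximiser if its supremum
    [mu] is positive. It is an eigenvector, and [mu] is at most every listed
    eigenvalue because the list is leading. The listed eigenvectors outside [K]
    and the maximiser then span a space of dimension [n - l + 1] on which
    [|T z|^2 >= mu b z z], so that the width is at least [mu^(1/2)]. Existence of
    the maximiser uses compactness of [T] on sets that are bounded in the norm
    of the Hilbert space, while maximising sequences are only bounded for [b];
    the two are reconciled by the open mapping theorem ([open_mapping]), since
    the space is complete for both. *)

(* Both names also belong to finite-dimensional linear algebra. *)
Local Notation span := Defs.span.
Local Notation form := Defs.form.

(** * Moduli and norms as real numbers *)

Section ComplexModulus.
Context {R : realType}.
Implicit Types z : R[i].

Lemma cabsE z : `|z| = (cabs z)%:C%C.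
Proof. by rewrite /cabs normc_def. Qed.

Lemma cabs_ge0 z : 0 <= cabs z.
Proof. by rewrite -lecR -cabsE; exact: normr_ge0. Qed.

Lemma cabs_sqr z : cabs z ^+ 2 = complex.Re z ^+ 2 + complex.Im z ^+ 2.
Proof.
by rewrite /cabs normc_def /= sqr_sqrtr // addr_ge0 // sqr_ge0.
Qed.

Lemma cabs_real (x : R) : 0 <= x -> cabs x%:C%C = x.
Proof. by move=> x0; rewrite /cabs ger0_norm // lecR. Qed.

Lemma le_Re_cabs z : complex.Re z <= cabs z.
Proof.
apply: (le_trans (ler_norm _)); rewrite -lecR -cabsE.
exact: normc_ge_Re.
Qed.

Lemma cabs_eq0 z : cabs z = 0 -> z = 0.
Proof. by move=> z0; apply/eqP; rewrite -normr_eq0 cabsE z0. Qed.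

Lemma ReD z1 z2 : complex.Re (z1 + z2) = complex.Re z1 + complex.Re z2.
Proof. by case: z1; case: z2. Qed.

Lemma ReN z : complex.Re (- z) = - complex.Re z.
Proof. by case: z. Qed.

Lemma Re_conj z : complex.Re (z^*) = complex.Re z.
Proof. by case: z. Qed.

Lemma conjC_ofreal (x : R) : (x%:C%C)^* = x%:C%C.
Proof. exact: conjc_real. Qed.

End ComplexModulus.

Section HilbertNorm.
Context {R : realType} {U : hilbertType R}.
Implicit Types u v : U.

Lemma hnormE u : `|u| = (hnorm u)%:C%C.
Proof. by rewrite /hnorm RRe_real // normr_real. Qed.

Lemma hnorm_ge0 u : 0 <= hnorm u.
Proof. by rewrite -lecR -hnormE; exact: normr_ge0. Qed.

Lemma hnorm_eq0 u : hnorm u = 0 -> u = 0.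
Proof. by move=> u0; apply/eqP; rewrite -normr_eq0 hnormE u0. Qed.

Lemma hnorm0 : hnorm (0 : U) = 0.
Proof. by rewrite /hnorm normr0. Qed.

Lemma ler_hnormD u v : hnorm (u + v) <= hnorm u + hnorm v.
Proof. by rewrite -lecR rmorphD /= -!hnormE ler_normD. Qed.

Lemma hnorm_scale a u : hnorm (a *: u) = cabs a * hnorm u.
Proof. by apply: complexI; rewrite rmorphM /= -cabsE -!hnormE normrZ. Qed.

Lemma hnorm_opp u : hnorm (- u) = hnorm u.
Proof. by rewrite /hnorm normrN. Qed.

Lemma hnorm_dist u v : hnorm (u - v) = hnorm (v - u).
Proof. by rewrite -hnorm_opp opprB. Qed.

End HilbertNorm.

(** * Hermitian forms *)

Section HermitianForms.
Context {R : realType} {U : hilbertType R}.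
Implicit Types (c : U -> U -> R[i]) (W : set U) (u v : U).

(** Bare functions rather than bundled forms: the forms that occur below, such
    as [mu b - (T ., T .)], are assembled from others, and are semidefinite
    only on subspaces. *)
Definition hermitian_fun c :=
  (forall v a x y, c (a *: x + y) v = a * c x v + c y v) /\
  (forall u v, c u v = (c v u)^*).

Definition qf c u : R := complex.Re (c u u).

Definition subspace W := W 0 /\ forall a u v, W u -> W v -> W (a *: u + v).

Variable c : U -> U -> R[i].
Hypothesis hc : hermitian_fun c.

Lemma hermitian_conj u v : c u v = (c v u)^*.
Proof. exact: hc.2. Qed.

Lemma herm_lin a x y v : c (a *: x + y) v = a * c x v + c y v.
Proof. exact: hc.1. Qed.

Lemma herm0l v : c 0 v = 0.
Proof.
have := herm_lin 1 0 0 v; rewrite scale1r addr0 mul1r => /eqP.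
by rewrite -subr_eq0 opprD addrA subrr sub0r oppr_eq0 => /eqP.
Qed.

Lemma hermZl a x v : c (a *: x) v = a * c x v.
Proof. by rewrite -[a *: x]addr0 herm_lin herm0l addr0. Qed.

Lemma hermDl x y v : c (x + y) v = c x v + c y v.
Proof. by rewrite -[x]scale1r herm_lin mul1r scale1r. Qed.

Lemma hermNl x v : c (- x) v = - c x v.
Proof. by rewrite -scaleN1r hermZl mulN1r. Qed.

Lemma hermBl x y v : c (x - y) v = c x v - c y v.
Proof. by rewrite hermDl hermNl. Qed.

Lemma herm0r v : c v 0 = 0.
Proof. by rewrite hermitian_conj herm0l conjC0. Qed.

Lemma hermDr x y v : c v (x + y) = c v x + c v y.
Proof. by rewrite !(hermitian_conj v) hermDl rmorphD. Qed.

Lemma hermZr a x v : c v (a *: x) = a^* * c v x.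
Proof. by rewrite !(hermitian_conj v) hermZl rmorphM. Qed.

Lemma hermNr x v : c v (- x) = - c v x.
Proof. by rewrite !(hermitian_conj v) hermNl rmorphN. Qed.

Lemma hermBr x y v : c v (x - y) = c v x - c v y.
Proof. by rewrite hermDr hermNr. Qed.

Lemma herm_suml (I : finType) (p : pred I) (f : I -> U) v :
  c (\sum_(i | p i) f i) v = \sum_(i | p i) c (f i) v.
Proof.
by apply: (big_morph (c^~ v)) => [x y|]; [exact: hermDl | exact: herm0l].
Qed.

Lemma herm_sumr (I : finType) (p : pred I) (f : I -> U) v :
  c v (\sum_(i | p i) f i) = \sum_(i | p i) c v (f i).
Proof.
by apply: (big_morph (c v)) => [x y|]; [exact: hermDr | exact: herm0r].
Qed.

Lemma herm_eq0C u v : c u v = 0 -> c v u = 0.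
Proof. by move=> uv; rewrite hermitian_conj uv conjC0. Qed.

Lemma herm_diag u : c u u = (qf c u)%:C%C.
Proof.
rewrite /qf; have : c u u = (c u u)^* by exact: hermitian_conj.
by case: (c u u) => x y [] /= y0; congr (_ +i* _)%C; lra.
Qed.

Lemma qf0 : qf c 0 = 0.
Proof. by rewrite /qf herm0l. Qed.

Lemma qfD u v : qf c (u + v) = qf c u + qf c v + 2 * complex.Re (c u v).
Proof.
rewrite /qf hermDl !hermDr !ReD (hermitian_conj v u) Re_conj; lra.
Qed.

Lemma qfZ a u : qf c (a *: u) = cabs a ^+ 2 * qf c u.
Proof.
rewrite /qf hermZl hermZr herm_diag cabs_sqr.
by case: a => a1 a2; rewrite /qf /=; ring.
Qed.

Lemma qfN u : qf c (- u) = qf c u.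
Proof. by rewrite /qf hermNl hermNr opprK. Qed.

Lemma qfB u v : qf c (u - v) = qf c u + qf c v - 2 * complex.Re (c u v).
Proof. by rewrite qfD qfN hermNr ReN mulrN. Qed.

Lemma qfD_ortho u v : c u v = 0 -> qf c (u + v) = qf c u + qf c v.
Proof. by move=> uv; rewrite qfD uv mulr0 addr0. Qed.

(** The discriminant argument along the line [u + a v]; positivity is only asked
    for on that line, since it may fail elsewhere. *)
Lemma herm_CS u v : 0 <= qf c v -> (forall a, 0 <= qf c (u + a *: v)) ->
  cabs (c u v) ^+ 2 <= qf c u * qf c v.
Proof.
move=> v0 pos.
set N := cabs (c u v) ^+ 2.
have key (t : R) : 0 <= qf c u - 2 * t * N + t ^+ 2 * N * qf c v.
  have := pos (- (t%:C%C * c u v)).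
  rewrite qfD qfZ hermZr /N.
  have -> : complex.Re ((- (t%:C%C * c u v))^* * c u v) = - (t * N).
    by rewrite /N cabs_sqr; case: (c u v) => x y /=; ring.
  have -> : cabs (- (t%:C%C * c u v)) ^+ 2 = t ^+ 2 * N.
    by rewrite /N !cabs_sqr; case: (c u v) => x y /=; ring.
  by rewrite -/N; lra.
have N0 : 0 <= N by exact: sqr_ge0.
have [vp|] := ltrP 0 (qf c v).
  have := key (qf c v)^-1.
  have -> : qf c u - 2 * (qf c v)^-1 * N + (qf c v)^-1 ^+ 2 * N * qf c v
      = qf c u - N / qf c v by field; rewrite gt_eqF.
  by rewrite subr_ge0 ler_pdivrMr.
move=> v0'; have {v0 v0'}vE : qf c v = 0 by apply/eqP; rewrite eq_le v0' v0.
rewrite vE mulr0; case: ltrP => // Np.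
have := key ((qf c u + 1) / (2 * N)).
rewrite vE mulr0 addr0.
have -> : 2 * ((qf c u + 1) / (2 * N)) * N = qf c u + 1.
  by field; rewrite gt_eqF.
lra.
Qed.

(** A vector at which a form vanishes minimises it, so it lies in the radical
    of every subspace on which the form is semidefinite. *)
Lemma herm_null W u v : subspace W -> (forall x, W x -> 0 <= qf c x) ->
  W u -> W v -> qf c u = 0 -> c u v = 0.
Proof.
move=> [W0 WD] pos Wu Wv u0.
have := @herm_CS u v (pos _ Wv) (fun a => _); rewrite u0 mul0r => cs.
apply: cabs_eq0; apply/eqP; rewrite -sqrf_eq0 eq_le sqr_ge0 andbT.
by apply: cs => a; rewrite addrC; apply/pos/WD.
Qed.

Section Semidefinite.
Hypothesis psd : forall u, 0 <= qf c u.

Lemma sqr_seminorm u : seminorm_of c u ^+ 2 = qf c u.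
Proof. by rewrite sqr_sqrtr //; exact: psd. Qed.

Lemma seminorm_ge0 u : 0 <= seminorm_of c u.
Proof. exact: sqrtr_ge0. Qed.

Lemma seminorm_CS u v : cabs (c u v) <= seminorm_of c u * seminorm_of c v.
Proof.
rewrite -(@ler_pXn2r _ 2) ?nnegrE ?mulr_ge0 ?seminorm_ge0 ?cabs_ge0 //.
by rewrite exprMn !sqr_seminorm herm_CS.
Qed.

Lemma seminormD u v : seminorm_of c (u + v) <= seminorm_of c u + seminorm_of c v.
Proof.
rewrite -(@ler_pXn2r _ 2) ?nnegrE ?addr_ge0 ?seminorm_ge0 //.
rewrite sqr_seminorm qfD sqrrD !sqr_seminorm.
have := le_trans (le_Re_cabs _) (seminorm_CS u v).
by rewrite mulr2n; lra.
Qed.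

Lemma seminormZ a u : seminorm_of c (a *: u) = cabs a * seminorm_of c u.
Proof.
apply/eqP; rewrite -(@eqrXn2 _ 2) ?mulr_ge0 ?seminorm_ge0 ?cabs_ge0 //.
by rewrite exprMn !sqr_seminorm qfZ.
Qed.

Lemma seminormN u : seminorm_of c (- u) = seminorm_of c u.
Proof. by congr Num.sqrt; exact: qfN. Qed.

Lemma seminorm_eq0 u v : seminorm_of c u = 0 -> c u v = 0.
Proof.
move=> u0; apply: cabs_eq0; apply/eqP; rewrite eq_le cabs_ge0 andbT.
by have := seminorm_CS u v; rewrite u0 mul0r.
Qed.

End Semidefinite.
End HermitianForms.

Lemma hermitian_sym_fun (R : realType) (U : hilbertType R)
  (b : {hermitian_sym U for (@Num.conj R[i])}) : hermitian_fun b.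
Proof.
split=> [v a x y|u v]; first by rewrite linearPl.
by rewrite hermC expr0 mul1r.
Qed.

Section InnerProduct.
Context {R : realType} {U : hilbertType R}.
Implicit Types u v : U.

Lemma inner_hermitian : hermitian_fun (@inner R U).
Proof.
split=> [v a x y|u v]; first by rewrite linearPl.
by rewrite hermC expr0 mul1r.
Qed.

Lemma qf_inner u : qf inner u = hnorm u ^+ 2.
Proof. by rewrite /qf inner_norm hnormE -rmorphXn. Qed.

Lemma qf_inner_ge0 u : 0 <= qf inner u.
Proof. by rewrite qf_inner sqr_ge0. Qed.

Lemma seminorm_inner u : seminorm_of inner u = hnorm u.
Proof.
by rewrite /seminorm_of -/(qf inner u) qf_inner sqrtr_sqr ger0_norm ?hnorm_ge0.
Qed.

Lemma inner_CS u v : cabs (inner u v) <= hnorm u * hnorm v.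
Proof.
rewrite -!seminorm_inner.
exact: (seminorm_CS inner_hermitian qf_inner_ge0).
Qed.

Lemma hnorm_sqrD_ortho u v : inner u v = 0 ->
  hnorm (u + v) ^+ 2 = hnorm u ^+ 2 + hnorm v ^+ 2.
Proof. by rewrite -!qf_inner; exact: (qfD_ortho inner_hermitian). Qed.

End InnerProduct.

Lemma pullback_hermitian (R : realType) (U V : hilbertType R)
  (T : {linear U -> V}) : hermitian_fun (fun u v => inner (T u) (T v)).
Proof.
split=> [v a x y|u v]; last exact: (hermitian_conj inner_hermitian).
by rewrite linearP (herm_lin inner_hermitian).
Qed.

Lemma hermitian_comb (R : realType) (U : hilbertType R)
  (b c : U -> U -> R[i]) (s t : R) : hermitian_fun b -> hermitian_fun c ->
  hermitian_fun (fun u v => s%:C%C * b u v + t%:C%C * c u v).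
Proof.
move=> hb hc; split=> [v a x y|u v].
  rewrite (herm_lin hb) (herm_lin hc); ring.
rewrite (hermitian_conj hb) (hermitian_conj hc) rmorphD !rmorphM /=.
by rewrite !conjC_ofreal.
Qed.

(** * Finite families of vectors *)

Section Spans.
Context {R : realType} {U : hilbertType R}.

Lemma subspace_sum (W : set U) (I : finType) (p : pred I) (f : I -> U)
    (a : I -> R[i]) :
  subspace W -> (forall i, p i -> W (f i)) -> W (\sum_(i | p i) a i *: f i).
Proof.
move=> [W0 WD] Wf; elim/big_ind: _ => // [x y Wx Wy|i pi].
  by rewrite -[x]scale1r; apply: WD.
by rewrite -[_ *: _]addr0; apply: WD => //; exact: Wf.
Qed.

Lemma subspaceB (W : set U) u v : subspace W -> W u -> W v -> W (u - v).
Proof. by move=> [_ WD] Wu Wv; rewrite addrC -scaleN1r; exact: WD. Qed.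

Lemma subspaceZ (W : set U) a u : subspace W -> W u -> W (a *: u).
Proof. by move=> [W0 WD] Wu; rewrite -[_ *: _]addr0; exact: WD. Qed.

Lemma subspaceD (W : set U) u v : subspace W -> W u -> W v -> W (u + v).
Proof. by move=> [W0 WD] Wu Wv; rewrite -[u]scale1r; exact: WD. Qed.

Variables (n : nat) (e : 'I_n -> U).

Lemma span_subspace : subspace (span e).
Proof.
split; first by exists (fun=> 0) => //; apply: big1 => i _; rewrite scale0r.
move=> a _ _ [x _ <-] [y _ <-]; exists (fun i => a * x i + y i) => //.
rewrite scaler_sumr -big_split; apply: eq_bigr => i _ /=.
by rewrite scalerDl scalerA.
Qed.

Lemma span_mem j : span e (e j).
Proof.
exists (fun i => (i == j)%:R) => //.
rewrite (bigD1 j) //= eqxx scale1r big1 ?addr0 // => i /negbTE ->.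
by rewrite scale0r.
Qed.

Lemma span_least (W : set U) : subspace W -> (forall j, W (e j)) ->
  span e `<=` W.
Proof. by move=> sW We _ [x _ <-]; exact: subspace_sum. Qed.

End Spans.

(** Gram-Schmidt for a semidefinite form. Where the form degenerates on the
    residual of a new vector, that vector constrains nothing more. *)
Lemma psd_projection (R : realType) (U : hilbertType R) (c : U -> U -> R[i])
    (n : nat) (e : 'I_n -> U) :
  hermitian_fun c -> (forall u, 0 <= qf c u) ->
  forall v, exists2 s, span e s & forall j, c (v - s) (e j) = 0.
Proof.
move=> hc psd; elim: n e => [|n IH] e v.
  by exists 0 => [|[]//]; exact: (span_subspace e).1.
pose e' j := e (widen_ord (leqnSn n) j).
have sub : span e' `<=` span e.
  by apply: span_least => [|j]; [exact: span_subspace | exact: span_mem].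
have [s sS sE] := IH e' v.
have [s' s'S s'E] := IH e' (e ord_max).
set x := e ord_max - s'.
have xS : span e x.
  by apply: subspaceB (span_mem _ _) (sub _ s'S); exact: span_subspace.
have ortho' t y : span e' y -> c (v - s - t *: x) y = 0.
  move=> [a _ <-]; rewrite (herm_sumr hc) big1 // => j _.
  by rewrite (hermZr hc) (hermBl hc) (hermZl hc) sE s'E mulr0 subrr mulr0.
have [t tE] : exists t, c (v - s - t *: x) x = 0.
  have [x0|x0] := eqVneq (c x x) 0; last first.
    by exists (c (v - s) x / c x x); rewrite (hermBl hc) (hermZl hc) mulfVK ?subrr.
  exists 0; rewrite scale0r subr0; apply: (herm_eq0C hc).
  by apply: (seminorm_eq0 hc psd); rewrite /seminorm_of x0 /= sqrtr0.
exists (s + t *: x).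
  by apply: subspaceD (sub _ sS) (subspaceZ _ _ xS); exact: span_subspace.
move=> j; rewrite opprD addrA.
have [jn|jn] := ltnP j n.
  have -> : e j = e' (Ordinal jn) by congr e; apply: val_inj.
  exact/ortho'/span_mem.
have -> : j = ord_max.
  by apply/val_inj/eqP; rewrite eqn_leq jn andbT -ltnS ltn_ord.
by rewrite -[e ord_max](subrK s') -/x (hermDr hc) tE (ortho' _ _ s'S) addr0.
Qed.

Lemma kernel_nontrivial (K : fieldType) (p q : nat) (A : 'I_p -> 'I_q -> K) :
  (q < p)%N ->
  exists2 x : 'I_p -> K, (exists i, x i != 0) &
    forall j, \sum_i x i * A i j = 0.
Proof.
move=> qp; pose M : 'M[K]_(p, q) := \matrix_(i, j) A i j.
have : kermx M != 0.
  rewrite -mxrank_eq0 mxrank_ker -lt0n subn_gt0.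
  exact: leq_ltn_trans (rank_leq_col _) qp.
case/matrix0Pn => i [k xk]; exists (fun k => kermx M i k); first by exists k.
move=> j; have : (kermx M *m M) i j = 0 by rewrite mulmx_ker mxE.
rewrite mxE => E; rewrite -[RHS]E.
by apply: eq_bigr => l _; rewrite [M _ _]mxE.
Qed.

Lemma lin_indep_span_leq (R : realType) (U : hilbertType R) (p q : nat)
    (e : 'I_p -> U) (f : 'I_q -> U) :
  lin_indep e -> (forall i, span f (e i)) -> (p <= q)%N.
Proof.
move=> ie fe; rewrite leqNgt; apply/negP => qp.
have /choice[A AE] : forall i, exists a : 'I_q -> R[i],
    \sum_(j < q) a j *: f j = e i.
  by move=> i; have [a _ ae] := fe i; exists a.
have [x [i xi] xA] := kernel_nontrivial A qp.
suff /ie /(_ i) /eqP : \sum_(i < p) x i *: e i = 0 by rewrite (negbTE xi).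
under eq_bigr => k _ do rewrite -AE scaler_sumr.
rewrite exchange_big /= big1 // => j _.
under eq_bigr => k _ do rewrite scalerA.
by rewrite -scaler_suml xA scale0r.
Qed.

(** * Sequences in Hilbert spaces *)

Section Sequences.
Context {R : realType} {U : hilbertType R}.

Lemma hnorm_cauchy_cvg (u : nat -> U) :
  (forall e : R, 0 < e -> exists N : nat, forall k m, (N <= k)%N -> (N <= m)%N ->
     hnorm (u k - u m) < e) ->
  exists l : U, forall e : R, 0 < e -> exists N : nat, forall k, (N <= k)%N ->
     hnorm (u k - l) < e.
Proof.
move=> cu.
have /cvg_ex[l ul] : cvg (u @ \oo).
  apply/cauchy_cvgP/cauchy_exP => eps eps0.
  have epsE : eps = (complex.Re eps)%:C%C by rewrite RRe_real // gtr0_real.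
  have [|N uN] := cu (complex.Re eps); first by rewrite -ltcR -epsE.
  exists (u N); exists N => // k /= Nk.
  by rewrite -ball_normE /= hnormE epsE ltcR; exact: uN.
exists l => e e0.
have /cvgrPdist_lt /(_ e%:C%C) := ul.
rewrite ltcR => /(_ e0) [N _ uN]; exists N => k Nk.
by have := uN k Nk; rewrite hnormE ltcR hnorm_dist.
Qed.

Lemma precompact_cluster (A : set U) (u : nat -> U) :
  precompact A -> (forall k, A (u k)) ->
  exists l : U, forall (e : R) (N : nat), 0 < e ->
    exists2 k, (N <= k)%N & hnorm (u k - l) < e.
Proof.
rewrite precompactE => cA Au.
have [|l [_ lu]] := cA (u @ \oo) _.
  by exists 0%N => // k _; exact/subset_closure/Au.
exists l => e N e0.
have [||_ [[k /= Nk <-] ]] := lu (u @` [set k | (N <= k)%N]) (ball l e%:C%C).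
- by exists N => // k Nk; exists k.
- by apply: nbhsx_ballx; rewrite ltcR.
by rewrite -ball_normE /= hnormE ltcR hnorm_dist => ?; exists k.
Qed.

End Sequences.

Lemma geometric_small (R : realType) (q C e : R) : 0 <= q < 1 -> 0 < e ->
  exists N : nat, forall k, (N <= k)%N -> C * q ^+ k < e.
Proof.
move=> /andP[q0 q1] e0.
have /cvgrPdist_lt /(_ _ e0) [N _ small] : geometric C q @ \oo --> 0.
  by apply: cvg_geometric; rewrite ger0_norm.
exists N => k /small; rewrite sub0r normrN /geometric /=.
exact/le_lt_trans/ler_norm.
Qed.

Lemma le_of_forall_ltD (R : realFieldType) (x y : R) :
  (forall e, 0 < e -> x < y + e) -> x <= y.
Proof.
move=> xy; apply/ler_addgt0Pr => e e0; exact/ltW/xy.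
Qed.

(** * The open mapping theorem for a complete semi-inner product *)

Section OpenMapping.
Context {R : realType} {U : hilbertType R}.
Variables (X : set U) (b : U -> U -> R[i]) (C : R).
Hypotheses (sX : subspace X) (hb : hermitian_fun b) (psd : forall u, 0 <= qf b u).
Hypothesis X_closed : forall (u : nat -> U) l, (forall k, X (u k)) ->
  (forall e : R, 0 < e -> exists N : nat, forall k, (N <= k)%N ->
     hnorm (u k - l) < e) -> X l.
Hypothesis b_bounded : forall u, seminorm_of b u <= C * hnorm u.
Hypothesis X_complete : complete_mod_kernel X b.

Local Notation s := (seminorm_of b).

Let s_ge0 u : 0 <= s u. Proof. exact: seminorm_ge0. Qed.

Let s_dist u v : s (u - v) = s (v - u).
Proof. by rewrite -(seminormN hb) opprB. Qed.

Let s_triangle u v w : s (u - w) <= s (u - v) + s (v - w).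
Proof.
by have -> : u - w = (u - v) + (v - w); [rewrite addrA subrK|exact: seminormD].
Qed.

(** Baire's argument, written out with nested balls: were every [b]-closure of
    [{v | X v /\ |v| <= n}] nowhere dense, the centres of shrinking [b]-balls
    that avoid these sets one after the other would converge to a vector of
    infinite norm. *)
Lemma baire_ball : exists n x (r : R), [/\ X x, 0 < r &
  forall y, X y -> s (y - x) < r -> forall e : R, 0 < e ->
    exists v, [/\ X v, hnorm v <= n%:R & s (y - v) < e]].
Proof.
apply: contrapT => nowhere.
have step (np : nat * (U * R)) : exists q : U * R, X np.2.1 -> 0 < np.2.2 ->
    [/\ X q.1, 0 < q.2, q.2 <= np.2.2 / 2, s (q.1 - np.2.1) + q.2 <= np.2.2 &
        forall v, X v -> hnorm v <= np.1%:R -> q.2 < s (q.1 - v)].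
  case: np => n [x r] /=.
  have [[Xx r0]|bad] := pselect (X x /\ 0 < r); last first.
    by exists (0, 0) => Xx r0; case: bad.
  have : ~ forall y, X y -> s (y - x) < r / 2 -> forall e : R, 0 < e ->
      exists v, [/\ X v, hnorm v <= n%:R & s (y - v) < e].
    by move=> H; apply: nowhere; exists n, x, (r / 2); split=> //; lra.
  move=> /existsNP[y /not_implyP[Xy /not_implyP[yx /existsNP[e /not_implyP[e0 H]]]]].
  exists (y, Num.min (e / 2) (r / 2)) => _ _ /=.
  have m1 : Num.min (e / 2) (r / 2) <= r / 2 by rewrite ge_min lexx orbT.
  have m2 : Num.min (e / 2) (r / 2) <= e / 2 by rewrite ge_min lexx.
  split=> //; [by rewrite lt_min; apply/andP; split; lra|lra|].
  move=> v Xv vn; apply: (le_lt_trans m2).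
  have : e <= s (y - v).
    by rewrite leNgt; apply/negP => ev; apply: H; exists v.
  lra.
have [f fP] := choice step.
pose p := fix p k := if k is k'.+1 then f (k', p k') else (0 : U, 1 : R).
have pP k : X (p k).1 /\ 0 < (p k).2.
  elim: k => [|k [Xk rk]]; first by split; [exact: sX.1 | exact: ltr01].
  by have [] := fP (k, p k) Xk rk.
have pS k := fP (k, p k) (pP k).1 (pP k).2.
have r_small k : (p k).2 <= (2^-1) ^+ k.
  elim: k => [|k IH]; first by rewrite expr0.
  by have [_ _ + _ _] := pS k; rewrite exprS /= mulrC => /le_trans->//;
    rewrite ler_wpM2l.
have nested N k : (N <= k)%N -> s ((p k).1 - (p N).1) + (p k).2 <= (p N).2.
  move=> /subnKC <-; elim: (k - N)%N => [|j IH].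
    by rewrite addn0 subrr (_ : s 0 = 0) ?add0r // /seminorm_of (herm0l hb) sqrtr0.
  rewrite addnS; have [_ _ _ + _] := pS (N + j)%N => /= pj.
  have := s_triangle (f ((N + j)%N, p (N + j)%N)).1 (p (N + j)%N).1 (p N).1.
  move: pj IH; set A := s _; set B := s (_ - (p N).1); lra.
have half : 0 <= (2^-1 : R) < 1 by rewrite invr_ge0 ler0n invf_lt1 ?ltr0n ?ltr1n.
have [e e0|v Xv pv] := X_complete (fun k => (pP k).1).
  have [N NP] := geometric_small 2 half e0; exists N => k m Nk Nm.
  have := s_triangle (p k).1 (p N).1 (p m).1; rewrite (s_dist (p N).1).
  have := nested _ _ Nk; have := nested _ _ Nm.
  have := NP N (leqnn N); have := r_small N; have := (pP k).2; have := (pP m).2.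
  lra.
have pv_near k : s ((p k).1 - v) <= (p k).2.
  apply: le_of_forall_ltD => e /pv[N NP].
  have := NP (maxn N k) (leq_maxl _ _).
  have := s_triangle (p k).1 (p (maxn N k)).1 v; rewrite (s_dist (p k).1 (p _).1).
  have := nested _ _ (leq_maxr N k); have := (pP (maxn N k)).2; lra.
have [_ _ _ _] := pS (Num.bound (hnorm v)).
move=> /(_ v Xv) far; have := pv_near (Num.bound (hnorm v)).+1.
rewrite leNgt far //.
by apply: ltW; rewrite archi_boundP ?hnorm_ge0.
Qed.

Lemma half_approximation : exists2 K : R, 0 <= K & forall u, X u ->
  exists v, [/\ X v, hnorm v <= K * s u & s (u - v) <= s u / 2].
Proof.
have [n [x [r [Xx r0 near]]]] := baire_ball.
have ball0 u : X u -> s u < r -> forall e : R, 0 < e ->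
    exists v, [/\ X v, hnorm v <= n%:R & s (u - v) < e].
  (* The set of approximable points is convex and symmetric. *)
  move=> Xu ur e e0.
  have [|v1 [Xv1 v1n v1e]] := near (x + u) (subspaceD sX Xx Xu) _ e e0.
    by rewrite addrAC subrr add0r.
  have [|v2 [Xv2 v2n v2e]] := near (x - u) (subspaceB sX Xx Xu) _ e e0.
    by rewrite addrAC subrr add0r (seminormN hb).
  have c2 : cabs ((2^-1 : R)%:C%C) = 2^-1 by rewrite cabs_real // invr_ge0.
  exists ((2^-1 : R)%:C%C *: (v1 - v2)); split.
  - by apply: subspaceZ => //; apply: subspaceB.
  - rewrite hnorm_scale c2; have := ler_hnormD v1 (- v2); rewrite hnorm_opp; lra.
  have -> : u - (2^-1 : R)%:C%C *: (v1 - v2) =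
      (2^-1 : R)%:C%C *: ((x + u - v1) - (x - u - v2)).
    rewrite [in RHS](_ : _ - _ = (u + u) - (v1 - v2)); last first.
      by rewrite !opprB !addrA [LHS](ACl (1*6*2*5*4*3)%AC) /= subrr add0r.
    rewrite [RHS]scalerBr [X in _ = X - _]scalerDr -scalerDl -rmorphD /=.
    by rewrite (_ : 2^-1 + 2^-1 = 1 :> R) ?rmorph1 ?scale1r //; field.
  rewrite seminormZ // c2.
  have := seminormD hb psd (x + u - v1) (- (x - u - v2)).
  rewrite (seminormN hb); lra.
exists (2 * n%:R / r); first by rewrite divr_ge0 ?mulr_ge0 ?ler0n ?(ltW r0).
move=> u Xu; have [su|su] := eqVneq (s u) 0.
  exists 0; split; first exact: sX.1.
  - by rewrite hnorm0 su mulr0.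
  by rewrite subr0 su mul0r.
have sp : 0 < s u by rewrite lt_neqAle eq_sym su s_ge0.
set t : R := r / (2 * s u).
have t0 : 0 < t by rewrite divr_gt0 // mulr_gt0.
have ct : cabs t%:C%C = t by rewrite cabs_real // ltW.
have cti : cabs (t^-1)%:C%C = t^-1 by rewrite cabs_real // invr_ge0 ltW.
have tE : s (t%:C%C *: u) = r / 2.
  by rewrite seminormZ // ct /t; field; rewrite su.
have [||v [Xv vn vE]] := ball0 (t%:C%C *: u) (subspaceZ _ sX Xu) _ (r / 4).
- by rewrite tE; lra.
- lra.
exists ((t^-1)%:C%C *: v); split; first exact: subspaceZ.
  rewrite hnorm_scale cti.
  have -> : 2 * n%:R / r * s u = t^-1 * n%:R by rewrite /t; field; rewrite su gt_eqF.
  by rewrite ler_wpM2l // invr_ge0 (ltW t0).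
have -> : u - (t^-1)%:C%C *: v = (t^-1)%:C%C *: (t%:C%C *: u - v).
  by rewrite scalerBr scalerA -rmorphM /= mulVf ?gt_eqF // rmorph1 scale1r.
rewrite seminormZ // cti.
have -> : s u / 2 = t^-1 * (r / 4) by rewrite /t; field; rewrite su gt_eqF.
by rewrite ler_wpM2l ?invr_ge0 ?(ltW t0) ?(ltW vE).
Qed.

(** Successive halving of the residual turns the approximation into an exact
    lift; it is here that completeness of the norm of [U] enters. *)
Theorem open_mapping : exists2 K : R, 0 <= K & forall u, X u ->
  exists v, [/\ X v, hnorm v <= K * s u & s (u - v) = 0].
Proof.
have [K K0 halve] := half_approximation.
have /choice[g gP] : forall u, exists v, X u ->
    [/\ X v, hnorm v <= K * s u & s (u - v) <= s u / 2].
  move=> u; have [/halve[v ?]|nXu] := pselect (X u); last by exists 0.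
  by exists v.
exists (2 * K); first by rewrite mulr_ge0.
move=> u Xu; pose w := fix w k := if k is k'.+1 then w k' - g (w k') else u.
have Xw k : X (w k).
  by elim: k => [//|k IH] /=; apply: subspaceB => //; have [] := gP _ IH.
have sw k : s (w k) <= (2^-1) ^+ k * s u.
  elim: k => [|k IH]; first by rewrite expr0 mul1r.
  have [_ _ /le_trans] := gP _ (Xw k); apply.
  by rewrite exprS -mulrA mulrC ler_wpM2l ?invr_ge0.
have dist0 k j : hnorm (w k - w (k + j)%N)
    <= 2 * K * s u * ((2^-1) ^+ k - (2^-1) ^+ (k + j)).
  elim: j => [|j IH]; first by rewrite addn0 !subrr hnorm0 mulr0.
  rewrite addnS /= opprB addrCA addrC.
  apply: (le_trans (ler_hnormD _ _)).
  have [_ gw _] := gP _ (Xw (k + j)%N).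
  have : K * s (w (k + j)%N) <= K * ((2^-1) ^+ (k + j) * s u) by rewrite ler_wpM2l.
  move: IH gw; rewrite exprS; set q := _ ^+ (k + j); set q' := _ ^+ k.
  set A := hnorm _; set B := hnorm _ ; move=> h1 h2 h3.
  suff -> : 2 * K * s u * (q' - 2^-1 * q) = 2 * K * s u * (q' - q) + K * (q * s u).
    by lra.
  by field.
have half : 0 <= (2^-1 : R) < 1 by rewrite invr_ge0 ler0n invf_lt1 ?ltr0n ?ltr1n.
have Ks0 : 0 <= 2 * K * s u by rewrite mulr_ge0 // mulr_ge0.
have dist k j : (k <= j)%N -> hnorm (w k - w j) <= 2 * K * s u * (2^-1) ^+ k.
  move=> /subnKC <-; apply: (le_trans (dist0 _ _)); apply: ler_wpM2l => //.
  by rewrite lerBlDr lerDl exprn_ge0 // (andP half).1.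
have [e e0|l ul] := @hnorm_cauchy_cvg R U (fun k => u - w k).
  have [N NP] := geometric_small (2 * (2 * K * s u)) half e0; exists N => k m Nk Nm.
  have -> : u - w k - (u - w m) = (w m - w N) + (w N - w k).
    by rewrite opprB addrC !subrKA.
  apply: (le_lt_trans (ler_hnormD _ _)).
  have := dist _ _ Nk; have := dist _ _ Nm; have := NP N (leqnn N).
  rewrite (hnorm_dist (w m)); set A := hnorm _; set B := hnorm _; lra.
exists l; split.
- by apply: X_closed ul => k; apply: subspaceB.
- apply: le_of_forall_ltD => e /ul[N /(_ N (leqnn N)) Ne].
  have := ler_hnormD (u - w N) (- (u - w N - l)); rewrite hnorm_opp.
  rewrite opprB addrC subrK.
  have := dist 0%N N (leq0n N); rewrite expr0 mulr1 /=; lra.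
apply/eqP; rewrite eq_le s_ge0 andbT; apply: le_of_forall_ltD => e e0.
rewrite add0r.
have C1 : 0 < `|C| + 1 by rewrite ltr_wpDl.
have [N1 N1P] := geometric_small (s u) half (divr_gt0 e0 (ltr0n _ 2)).
have [|N2 N2P] := ul (e / 2 / (`|C| + 1)); first by rewrite !divr_gt0.
set k := maxn N1 N2.
have := s_triangle u (u - w k) l; rewrite subKr.
have := sw k; have := N1P k (leq_maxl _ _); have := N2P k (leq_maxr _ _).
have := b_bounded (u - w k - l).
rewrite ltr_pdivlMr // => h1 h2 h3 h4 h5.
have : C * hnorm (u - w k - l) <= hnorm (u - w k - l) * (`|C| + 1).
  rewrite mulrC ler_wpM2l ?hnorm_ge0 //.
  by rewrite (le_trans (ler_norm C)) // lerDl.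
rewrite mulrC in h3; lra.
Qed.

End OpenMapping.

(** * Widths and leading eigenpairs *)

Lemma lin_indep_comp (R : realType) (U : hilbertType R) (p q : nat)
    (e : 'I_q -> U) (f : 'I_p -> 'I_q) :
  injective f -> lin_indep e -> lin_indep (e \o f).
Proof.
move=> fI ie c ce i.
have := ie (fun j => \sum_(k | f k == j) c k).
rewrite (_ : \sum_(j < q) _ = 0); last first.
  rewrite -[RHS]ce (partition_big f predT) //=; apply: eq_bigr => j _.
  by rewrite scaler_suml; apply: eq_bigr => k /eqP <-.
move=> /(_ erefl (f i)); rewrite (big_pred1 i) // => k /=.
by rewrite (inj_eq fI).
Qed.

Lemma le_hnorm_dist_ortho (R : realType) (U : hilbertType R) (m : nat)
    (f : 'I_m -> U) (y : U) :
  (forall j, inner y (f j) = 0) -> hnorm y <= dist y (span f).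
Proof.
move=> yf; apply: lb_le_inf.
  by exists (hnorm (y - 0)), 0 => //; exact: (span_subspace f).1.
move=> _ [q [a _ <-] <-]; rewrite -(@ler_pXn2r _ 2) ?nnegrE ?hnorm_ge0 //.
rewrite hnorm_sqrD_ortho ?lerDl ?sqr_ge0 //.
rewrite (hermNr inner_hermitian) (herm_sumr inner_hermitian) big1 ?oppr0 // => j _.
by rewrite (hermZr inner_hermitian) yf mulr0.
Qed.

(** With [z] the given combination and [y = \sum_i sqrt (r i - mu) c_i e_i], one
    has [|T z|^2 - mu b z z = b y y], because [b (e i) (e j)] vanishes unless
    [r i = r j]. *)
Lemma eigen_family_lower (R : realType) (U V : hilbertType R)
    (T : {linear U -> V}) (b : U -> U -> R[i]) (m : nat) (e : 'I_m -> U)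
    (r : 'I_m -> R) (mu : R) (c : 'I_m -> R[i]) :
  hermitian_fun b -> (forall u, 0 <= qf b u) ->
  (forall i j, inner (T (e i)) (T (e j)) = (r i)%:C%C * b (e i) (e j)) ->
  (forall i, mu <= r i) ->
  mu * qf b (\sum_i c i *: e i) <= hnorm (T (\sum_i c i *: e i)) ^+ 2.
Proof.
move=> hb psd er mur; set z := \sum_i _.
have sym i j : b (e i) (e j) = 0 \/ r i = r j.
  have [->|bij] := eqVneq (b (e i) (e j)) 0; [by left|right].
  have := er i j; rewrite (hermitian_conj inner_hermitian) er rmorphM /=.
  rewrite -(hermitian_conj hb) conjC_ofreal => /(mulIf bij) [].
  by move=> ->.
pose q i := Num.sqrt (r i - mu).
rewrite -subr_ge0.
suff -> : hnorm (T z) ^+ 2 - mu * qf b z =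
    qf b (\sum_i ((q i)%:C%C * c i) *: e i) by exact: psd.
rewrite -qf_inner; apply: complexI.
rewrite rmorphB rmorphM /= -(herm_diag inner_hermitian) -!(herm_diag hb).
rewrite /z linear_sum (herm_suml inner_hermitian) !(herm_suml hb) mulr_sumr -sumrB.
apply: eq_bigr => i _.
rewrite (herm_sumr inner_hermitian) !(herm_sumr hb) mulr_sumr -sumrB.
apply: eq_bigr => j _.
rewrite ![T (_ *: _)]linearZ /= (hermZl inner_hermitian) (hermZr inner_hermitian) er.
rewrite !(hermZl hb) !(hermZr hb) rmorphM /=.
have [->|rij] := sym i j; first by rewrite !mulr0 subrr.
rewrite conjC_ofreal.
have -> : (r i)%:C%C = mu%:C%C + (q i)%:C%C * (q j)%:C%C.
  rewrite -rmorphM -rmorphD /= /q -rij -expr2 sqr_sqrtr ?subr_ge0 //.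
  by rewrite addrC subrK.
by ring.
Qed.

Section Width.
Context {R : realType} {U V : hilbertType R}.
Variables (T : {linear U -> V}) (X K : set U) (b : U -> U -> R[i]).
Hypotheses (sX : subspace X) (hb : hermitian_fun b) (psd : forall u, 0 <= qf b u).
Hypothesis X_closed : forall (u : nat -> U) l, (forall k, X (u k)) ->
  (forall e : R, 0 < e -> exists N : nat, forall k, (N <= k)%N ->
     hnorm (u k - l) < e) -> X l.
Hypothesis b_bounded : bounded_form b.
Hypothesis X_complete : complete_mod_kernel X b.
Variables (l n : nat).
Hypotheses (K_dim : has_dim l K) (KX : K `<=` X).
Hypothesis K_radical : forall v, X v -> (forall u, b v u = 0) <-> K v.
Hypothesis T_inj : forall u v, K u -> K v -> T u = T v -> u = v.
Hypotheses (T_bounded : bounded_map T) (T_compact : compact_on X T).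
Variables (lam : 'I_n -> \bar R) (phi : 'I_n -> U).
Hypotheses (ln : (l < n)%N) (eigen : leading_eigenpairs X K T b lam phi).

Local Notation s := (seminorm_of b).

Let X0 : set U := [set v | X v /\ forall w, K w -> inner (T v) (T w) = 0].

(** The forms [(T ., T .) + b] and [mu b - (T ., T .)]. Orthogonality to the
    eigenvectors for the first one means orthogonality for both [b] and
    [(T ., T .)], whether the eigenvalue is finite or not. *)
Let pencil (p q : R) (u v : U) : R[i] :=
  p%:C%C * inner (T u) (T v) + q%:C%C * b u v.

Let pencil_herm p q : hermitian_fun (pencil p q).
Proof. exact/hermitian_comb/hb/pullback_hermitian. Qed.

Let qf_pencil p q u : qf (pencil p q) u = p * hnorm (T u) ^+ 2 + q * qf b u.
Proof.
rewrite /qf /pencil -qf_inner (herm_diag inner_hermitian) (herm_diag hb) /qf.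
by rewrite ReD -!rmorphM.
Qed.

Let phiX j : X (phi j).
Proof. by have [/(_ j)[]] := eigen. Qed.

Let K0 : K 0.
Proof. by have [e [_ ->]] := K_dim; exact: (span_subspace e).1. Qed.

Let b_K u k : K k -> b u k = 0.
Proof. by move=> Kk; apply: (herm_eq0C hb); exact: ((K_radical (KX Kk)).2 Kk). Qed.

(** [l + 1] independent eigenvectors do not fit into [K], so the list, which is
    ordered, leaves the eigenvalue [+oo] at position [l] at the latest. *)
Let finite_eigenvalue (j : 'I_n) : (l <= j)%N -> exists r : R, lam j = r%:E.
Proof.
move=> lj; have [ep ie antitone _] := eigen.
have : lam (Ordinal ln) != +oo%E.
  apply/eqP => loo; have [f [_ Kf]] := K_dim.
  pose g := widen_ord ln.
  have gI : injective g by move=> x y [] /val_inj.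
  suff : (l.+1 <= l)%N by rewrite ltnn.
  apply: (@lin_indep_span_leq _ _ _ _ (phi \o g) f (lin_indep_comp gI ie)) => i.
  have gl : (g i <= l)%N by exact: (ltn_ord i).
  rewrite -Kf; have := antitone (g i) (Ordinal ln) gl.
  rewrite loo leye_eq => /eqP gi.
  by have [_ _] := ep (g i); rewrite gi.
have := antitone (Ordinal ln) j lj; have [_ _] := ep j.
case: (lam j) => [r _ _ _|_|//]; first by exists r.
by rewrite leye_eq => ->.
Qed.

Let eigen_rel j r v : lam j = r%:E -> X v ->
  inner (T (phi j)) (T v) = r%:C%C * b (phi j) v.
Proof. by move=> jr; have [/(_ j)[_ _]] := eigen; rewrite jr => + _ _ _; apply. Qed.

(** Since the list is leading, no vector of [K] is missing before the first
    finite eigenvalue. *)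
Let K_span : K `<=` span phi.
Proof.
move=> k Kk; have [->|k0] := eqVneq k 0; first exact: (span_subspace phi).1.
have [r lr] := finite_eigenvalue (leqnn (Ordinal ln : nat)).
have [_ _ _ /(_ (Ordinal ln) +oo%E k)[]] := eigen; first by split=> //; exact: KX.
  by rewrite lr ltry.
move=> c ->; apply: subspace_sum => [|j _]; [exact: span_subspace|exact: span_mem].
Qed.

Let W : set U := [set x | X x /\ forall j, pencil 1 1 x (phi j) = 0].

Let W_subspace : subspace W.
Proof.
split; first by split=> [|j]; [exact: sX.1 | exact: (herm0l (pencil_herm 1 1))].
move=> a u v [Xu cu] [Xv cv]; split; first exact: sX.2.
by move=> j; rewrite (herm_lin (pencil_herm 1 1)) cu cv mulr0 addr0.
Qed.

Let W_K x k : W x -> K k -> inner (T x) (T k) = 0.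
Proof.
move=> [_ cx] Kk; have [a _ ak] := K_span Kk.
have : pencil 1 1 x k = 0.
  rewrite -ak (herm_sumr (pencil_herm 1 1)) big1 // => j _.
  by rewrite (hermZr (pencil_herm 1 1)) cx mulr0.
by rewrite /pencil b_K // mulr0 addr0 mul1r.
Qed.

Let W_phi x j : W x -> b x (phi j) = 0 /\ inner (T x) (T (phi j)) = 0.
Proof.
move=> Wx; have [Xx cx] := Wx.
have [_ _] := (let: And4 ep _ _ _ := eigen in ep j).
case lj : (lam j) => [r||//]; last by move=> Kj; rewrite b_K // W_K.
move=> _; have := cx j; rewrite /pencil !mul1r.
rewrite (hermitian_conj inner_hermitian) (hermitian_conj hb) (eigen_rel lj Xx).
suff -> : b (phi j) x = 0 by rewrite mulr0 conjC0.
have : pencil 1 1 (phi j) x = 0 by apply: (herm_eq0C (pencil_herm 1 1)).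
rewrite /pencil !mul1r (eigen_rel lj Xx) -[X in _ + X]mul1r -mulrDl.
move=> /eqP; rewrite mulf_eq0 => /orP[/eqP r1|/eqP //].
apply: (seminorm_eq0 hb psd); rewrite /seminorm_of -/(qf b _).
suff -> : qf b (phi j) = 0 by rewrite sqrtr0.
have {}r1 : r = -1 by case: r1 => r1; lra.
have := qf_inner (T (phi j)); rewrite /qf (eigen_rel lj (phiX j)) r1.
rewrite (herm_diag hb) -rmorphM /= => E.
have := psd (phi j); have := sqr_ge0 (hnorm (T (phi j))); lra.
Qed.

Let W_span x y : W x -> span phi y -> b x y = 0 /\ inner (T x) (T y) = 0.
Proof.
move=> Wx [a _ <-]; split.
  rewrite (herm_sumr hb) big1 // => j _.
  by rewrite (hermZr hb) (W_phi j Wx).1 mulr0.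
rewrite linear_sum (herm_sumr inner_hermitian) big1 // => j _.
by rewrite linearZ (hermZr inner_hermitian) (W_phi j Wx).2 mulr0.
Qed.

Let W_decomposition z : X z -> exists2 y, span phi y & W (z - y).
Proof.
move=> Xz; have [|y Sy yE] := @psd_projection _ _ (pencil 1 1) n phi
    (pencil_herm 1 1) _ z.
  by move=> u; rewrite qf_pencil !mul1r addr_ge0 ?sqr_ge0.
exists y => //; split=> //; apply: subspaceB => //.
exact: span_least Sy.
Qed.

Let K_seminorm0 x : X x -> s x = 0 -> K x.
Proof.
move=> Xx x0; apply/(K_radical Xx) => u; exact: seminorm_eq0 x0.
Qed.

(** As [T x] is orthogonal to [T K], the norm of [T] on [x + K] is least at
    [x]. *)
Let W_T_le x x' : W x -> K (x - x') -> hnorm (T x) <= hnorm (T x').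
Proof.
move=> Wx Kx; rewrite -(@ler_pXn2r _ 2) ?nnegrE ?hnorm_ge0 //.
have -> : T x' = T x + - T (x - x') by rewrite linearB opprB addrC subrK.
rewrite hnorm_sqrD_ortho ?lerDl ?sqr_ge0 //.
by rewrite (hermNr inner_hermitian) W_K // oppr0.
Qed.

Let seminorm_bounded : exists C : R, forall u, s u <= C * hnorm u.
Proof.
have [C hC] := b_bounded; exists (Num.sqrt `|C|) => u.
rewrite -(@ler_pXn2r _ 2) ?nnegrE ?mulr_ge0 ?sqrtr_ge0 ?hnorm_ge0 //.
rewrite (sqr_seminorm psd) exprMn sqr_sqrtr // expr2 mulrA.
apply: (le_trans (le_Re_cabs _)); apply: (le_trans (hC u u)).
by rewrite !ler_wpM2r ?hnorm_ge0 // ler_norm.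
Qed.

(** Compactness of [T] refers to the norm of [U]; this brings [b]-bounded
    sequences within its reach, up to [K]. *)
Let bounded_lift : exists2 C : R, 0 <= C & forall u, X u ->
  exists v, [/\ X v, hnorm v <= C * s u & K (u - v)].
Proof.
have [C hC] := seminorm_bounded.
have [C' C'0 H] := open_mapping sX hb psd X_closed hC X_complete.
exists C' => // u Xu; have [v [Xv vu uv]] := H u Xu; exists v; split=> //.
by apply: K_seminorm0 => //; exact: subspaceB.
Qed.

Let W_T_bounded : exists2 C : R, 0 <= C & forall x, W x -> hnorm (T x) <= C * s x.
Proof.
have [C C0 H] := bounded_lift; have [CT hT] := T_bounded.
exists (`|CT| * C) => [|x Wx]; first exact: mulr_ge0.
have [x' [_ x'x Kx]] := H x Wx.1.
apply: (le_trans (W_T_le Wx Kx)); apply: (le_trans (hT _)).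
rewrite -mulrA; apply: (@le_trans _ _ (`|CT| * hnorm x')).
  by rewrite ler_wpM2r ?hnorm_ge0 ?ler_norm.
exact: ler_wpM2l.
Qed.

Let sphere_values : set R := [set hnorm (T x) ^+ 2 | x in [set x | W x /\ s x <= 1]].
Let mu : R := sup sphere_values.

Let sphere_has_sup : has_sup sphere_values.
Proof.
split.
  exists (hnorm (T 0) ^+ 2), 0 => //; split; first exact: W_subspace.1.
  by rewrite /seminorm_of (herm0l hb) sqrtr0.
have [C C0 H] := W_T_bounded; exists (C ^+ 2) => _ [x [Wx x1] <-].
rewrite ler_pXn2r ?nnegrE ?hnorm_ge0 //; apply: (le_trans (H x Wx)).
by rewrite -[leRHS]mulr1 ler_wpM2l.
Qed.

Let mu_bound x : W x -> hnorm (T x) ^+ 2 <= mu * qf b x.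
Proof.
move=> Wx; have [x0|x0] := eqVneq (s x) 0.
  have [C _ /(_ x Wx)] := W_T_bounded; rewrite x0 mulr0 => Tx.
  have -> : hnorm (T x) = 0 by apply/eqP; rewrite eq_le Tx hnorm_ge0.
  by rewrite expr0n -(sqr_seminorm psd) x0 expr0n mulr0.
have xp : 0 < s x by rewrite lt_neqAle eq_sym x0 seminorm_ge0.
have cE : cabs ((s x)^-1)%:C%C = (s x)^-1 by rewrite cabs_real // invr_ge0 ltW.
have : hnorm (T (((s x)^-1)%:C%C *: x)) ^+ 2 <= mu.
  apply: ub_le_sup; first exact: sphere_has_sup.2.
  exists (((s x)^-1)%:C%C *: x) => //; split; first exact: subspaceZ.
  by rewrite seminormZ // cE mulVf.
rewrite linearZ hnorm_scale /= cE exprMn exprVn -(sqr_seminorm psd).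
by rewrite mulrC ler_pdivrMr // exprn_gt0.
Qed.

(** By the parallelogram identity a maximising sequence is [b]-Cauchy as soon as
    its image under [T] is Cauchy, which compactness provides. *)
Let maximiser : 0 < mu ->
  exists psi, [/\ W psi, hnorm (T psi) ^+ 2 = mu & qf b psi = 1].
Proof.
move=> mu0; have [C C0 liftP] := bounded_lift; have C10 : 0 < C + 1 by lra.
pose d k : R := k.+1%:R^-1.
have d0 k : 0 < d k by rewrite invr_gt0.
have d_le k m : (k <= m)%N -> d m <= d k.
  by move=> km; rewrite lef_pV2 ?posrE // ler_nat.
have d_small e : 0 < e -> exists N, d N < e.
  move=> e0; exists (Num.bound e^-1); rewrite /d -[ltRHS]invrK ltf_pV2 ?posrE ?invr_gt0 //.
  apply: (@lt_le_trans _ _ (Num.bound e^-1)%:R); last by rewrite ler_nat.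
  by rewrite archi_boundP // invr_ge0 ltW.
have /choice[z zP] : forall k, exists z : U * U, [/\ W z.1, s z.1 <= 1,
    mu - d k < hnorm (T z.1) ^+ 2, X z.2 /\ hnorm z.2 <= C & K (z.1 - z.2)].
  move=> k; have [_ [z [Wz z1] <-] zk] := sup_adherent (d0 k) sphere_has_sup.
  have [z' [Xz' z'z Kz]] := liftP z Wz.1.
  exists (z, z'); split=> //; split=> //; apply: (le_trans z'z).
  by rewrite -[leRHS]mulr1 ler_wpM2l.
(* Rescales the lifts [(z k).2] into the unit ball. *)
pose a : R := (C + 1)^-1.
have a0 : 0 < a by rewrite invr_gt0.
have ca : cabs a%:C%C = a by rewrite cabs_real // ltW.
have [k|y yP] := precompact_cluster T_compact (u := fun k => T (a%:C%C *: (z k).2)).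
  have [_ _ _ [Xz zC] _] := zP k; exists (a%:C%C *: (z k).2) => //.
  split; first exact: subspaceZ.
  by rewrite hnorm_scale ca mulrC ler_pdivrMr // mul1r; lra.
have /choice[f fP] : forall k, exists m, (k <= m)%N /\
    hnorm (T (a%:C%C *: (z m).2) - y) < d k.
  by move=> k; have [m km ym] := yP (d k) k (d0 k); exists m.
pose x k := (z (f k)).1.
have Wx k : W (x k) by have [] := zP (f k).
have x1 k : s (x k) <= 1 by have [] := zP (f k).
have xT k : mu - d k < hnorm (T (x k)) ^+ 2.
  have [_ _ + _ _] := zP (f k); have := d_le _ _ (fP k).1; rewrite /x; lra.
have T_cauchy k m : hnorm (T (x k - x m)) <= (C + 1) * (d k + d m).
  apply: (@le_trans _ _ (hnorm (T ((z (f k)).2 - (z (f m)).2)))).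
    apply: W_T_le; first exact: subspaceB.
    have [_ _ _ _ Kk] := zP (f k); have [_ _ _ _ Km] := zP (f m).
    have [e [_ KE]] := K_dim.
    have -> : x k - x m - ((z (f k)).2 - (z (f m)).2) =
        ((z (f k)).1 - (z (f k)).2) - ((z (f m)).1 - (z (f m)).2).
      by rewrite !opprB !addrA /x [LHS](ACl (1*4*3*2)%AC).
    by move: Kk Km; rewrite KE => Kk Km; apply: subspaceB => //; exact: span_subspace.
  rewrite -ler_pdivrMl // -/a -ca -hnorm_scale -linearZ /= scalerBr linearB.
  rewrite -(subrKA y).
  apply: (le_trans (ler_hnormD _ _)); rewrite [X in _ + X <= _]hnorm_dist.
  by apply: lerD; apply: ltW; apply: (fP _).2.
have b_cauchy k m : mu * qf b (x k - x m) <=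
    2 * (d k + d m) + ((C + 1) * (d k + d m)) ^+ 2.
  have h1 := mu_bound (subspaceD W_subspace (Wx k) (Wx m)).
  have h2 : hnorm (T (x k - x m)) ^+ 2 <= ((C + 1) * (d k + d m)) ^+ 2.
    rewrite ler_pXn2r ?nnegrE ?hnorm_ge0 ?T_cauchy //.
    by rewrite mulr_ge0 ?addr_ge0 ?invr_ge0 // ltW.
  move: h1 h2; rewrite linearD linearB -!qf_inner.
  rewrite (qfD inner_hermitian) (qfB inner_hermitian) (qfD hb) (qfB hb).
  rewrite !qf_inner mulrBr !mulrDr.
  have le1 i : mu * qf b (x i) <= mu.
    rewrite -[leRHS]mulr1 ler_wpM2l ?(ltW mu0) //.
    by rewrite -(sqr_seminorm psd) exprn_ile1 ?seminorm_ge0.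
  have := le1 k; have := le1 m; have := xT k; have := xT m; lra.
have [e e0|v Xv vP] := X_complete (fun k => (Wx k).1).
  have [N NP] : exists N, d N < Num.min 1 (mu * e ^+ 2 / (4 + 4 * (C + 1) ^+ 2)).
    apply: d_small; rewrite lt_min ltr01 divr_gt0 ?mulr_gt0 ?exprn_gt0 //.
    by rewrite ltr_wpDr // mulr_ge0 ?sqr_ge0.
  exists N => k m /d_le kN /d_le mN.
  rewrite -(@ltr_pXn2r _ 2) ?nnegrE ?seminorm_ge0 ?(ltW e0) //.
  rewrite (sqr_seminorm psd) -(ltr_pM2l mu0).
  apply: (le_lt_trans (b_cauchy k m)).
  move: NP; rewrite lt_min ltr_pdivlMr; last first.
    by rewrite ltr_wpDr // mulr_ge0 ?sqr_ge0.
  move=> /andP[N1]; apply: le_lt_trans.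
  rewrite exprMn [leRHS]mulrDr; apply: lerD; first by lra.
  have -> : d N * (4 * (C + 1) ^+ 2) = (C + 1) ^+ 2 * (4 * d N) by ring.
  apply: ler_wpM2l; first exact: sqr_ge0.
  apply: (@le_trans _ _ ((2 * d N) ^+ 2)).
    rewrite ler_pXn2r ?nnegrE ?addr_ge0 ?mulr_ge0 ?(ltW (d0 _)) //; lra.
  rewrite exprMn -natrX expr2 mulrA ler_pM2r ?d0 //.
  by rewrite -[leRHS]mulr1 ler_wpM2l // ltW.
have v_phi j : b v (phi j) = 0.
  apply: cabs_eq0; apply/eqP; rewrite eq_le cabs_ge0 andbT.
  apply: le_of_forall_ltD => e e0; rewrite add0r.
  have [|N /(_ N (leqnn N)) NP] := vP (e / (s (phi j) + 1)).
    by rewrite divr_gt0 // ltr_wpDl ?seminorm_ge0.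
  have -> : b v (phi j) = - b (x N - v) (phi j).
    by rewrite (hermBl hb) (W_phi j (Wx N)).1 sub0r opprK.
  rewrite /cabs normrN -/(cabs _).
  apply: (le_lt_trans (seminorm_CS hb psd _ _)).
  move: NP; rewrite ltr_pdivlMr ?ltr_wpDl ?seminorm_ge0 //.
  by apply: le_lt_trans; rewrite ler_wpM2l ?seminorm_ge0 // lerDl.
(* The [b]-limit [v] is only determined up to the radical and need not lie in
   [W]; its component [t] along the span has seminorm zero. *)
have [t St Wpsi] := W_decomposition Xv; set psi := v - t in Wpsi.
have t0 : s t = 0.
  rewrite /seminorm_of; have [c _ tE] := St.
  rewrite -{2}tE (herm_sumr hb) big1 ?sqrtr0 // => j _.
  rewrite (hermZr hb) -[t](subKr v) -/psi (hermBl hb) v_phi (W_phi j Wpsi).1.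
  by rewrite subr0 mulr0.
have psi_near k : s (x k - psi) <= s (x k - v).
  have -> : x k - psi = (x k - v) + t by rewrite /psi opprB addrCA addrC.
  by apply: (le_trans (seminormD hb psd _ _)); rewrite t0 addr0.
have psi1 : s psi <= 1.
  apply: le_of_forall_ltD => e /vP[N /(_ N (leqnn N)) Ne].
  have := seminormD hb psd (x N) (- (x N - psi)); rewrite seminormN // subKr.
  have := psi_near N; have := x1 N; lra.
have qf1 : qf b psi <= 1.
  by rewrite -(sqr_seminorm psd) exprn_ile1 ?seminorm_ge0.
have psi_mu : mu <= hnorm (T psi) ^+ 2.
  have [CT CT0 HT] := W_T_bounded.
  apply: le_of_forall_ltD => e0 e00.
  set A := hnorm (T psi); have A0 : 0 <= A by exact: hnorm_ge0.
  pose e := Num.min 1 (e0 / (2 * A + 2)).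
  have A2 : 0 < 2 * A + 2 by lra.
  have ep : 0 < e by rewrite lt_min ltr01 divr_gt0.
  have e1 : e <= 1 by rewrite ge_min lexx.
  have eA : e * (2 * A + 2) <= e0 by rewrite -ler_pdivlMr // ge_min lexx orbT.
  have [N1 N1P] := d_small e ep.
  have [|N2 N2P] := vP (e / (CT + 1)); first by rewrite divr_gt0 //; lra.
  set k := maxn N1 N2.
  have Tk : hnorm (T (x k)) <= A + e.
    have := ler_hnormD (T psi) (T (x k - psi)); rewrite -linearD addrC subrK.
    have := HT _ (subspaceB W_subspace (Wx k) Wpsi).
    have := N2P k (leq_maxr _ _); rewrite ltr_pdivlMr ?ltr_wpDl //.
    have := psi_near k => h1 h2 h3.
    have : CT * s (x k - psi) <= CT * s (x k - v) by rewrite ler_wpM2l.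
    have := seminorm_ge0 b (x k - v); rewrite -/A; lra.
  have : hnorm (T (x k)) ^+ 2 <= (A + e) ^+ 2.
    by rewrite ler_pXn2r ?nnegrE ?hnorm_ge0 // addr_ge0 // ltW.
  have := xT k; have := d_le _ _ (leq_maxl N1 N2).
  have ee : e ^+ 2 <= e by rewrite expr2 -[leRHS]mulr1 ler_wpM2l // ltW.
  rewrite sqrrD mulr2n; lra.
have := mu_bound Wpsi => up.
have q1 : qf b psi = 1.
  apply/eqP; rewrite eq_le qf1 -(ler_pM2l mu0) mulr1; exact: le_trans up.
exists psi; split=> //; apply/eqP; rewrite eq_le psi_mu andbT.
by rewrite q1 mulr1 in up.
Qed.

Let maximiser_eigen psi v : W psi -> hnorm (T psi) ^+ 2 = mu -> qf b psi = 1 ->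
  X v -> inner (T psi) (T v) = mu%:C%C * b psi v.
Proof.
move=> Wpsi Tpsi psi1 Xv; have [y Sy Wvy] := W_decomposition Xv.
have : pencil (-1) mu psi (v - y) = 0.
  apply: (herm_null (pencil_herm _ _) W_subspace) => //.
    by move=> x Wx; rewrite qf_pencil mulN1r addrC subr_ge0 mu_bound.
  by rewrite qf_pencil Tpsi psi1; lra.
rewrite /pencil rmorphN1 mulN1r linearB (hermBr inner_hermitian) (hermBr hb).
have [-> ->] := W_span Wpsi Sy; rewrite !subr0 => /eqP.
by rewrite addrC subr_eq0 => /eqP ->.
Qed.

(** Otherwise [psi] would precede [phi j], hence lie in the span of the list,
    to which it is orthogonal. *)
Let mu_le_eigenvalue psi j r : W psi -> hnorm (T psi) ^+ 2 = mu ->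
  qf b psi = 1 -> lam j = r%:E -> mu <= r.
Proof.
move=> Wpsi Tpsi psi1 lj; rewrite leNgt; apply/negP => rmu.
have [_ _ _ /(_ j mu%:E psi)] := eigen; rewrite lj lte_fin => /(_ _ rmu)[].
  split; [|exact: Wpsi.1|by move=> v; exact: maximiser_eigen].
  apply/eqP => psi0; move: psi1; rewrite psi0 (qf0 hb); lra.
move=> c psiE; have Spsi : span phi psi.
  rewrite psiE; apply: subspace_sum => [|k _]; first exact: span_subspace.
  exact: span_mem.
have := (W_span Wpsi Spsi).1; rewrite (herm_diag hb) psi1 => /eqP.
by rewrite rmorph1 oner_eq0.
Qed.

(** The eigenvectors with finite eigenvalue together with the maximiser span
    a space of dimension [n - l + 1] in [X0] on which [|T z|^2 >= mu b z z]; for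
    every [Q] of dimension [n - l] it contains a nonzero [z] with [T z]
    orthogonal to [Q]. *)
Let mu_le_width : 0 < mu -> ((Num.sqrt mu)%:E <= nwidth (n - l) X0 T b)%E.
Proof.
move=> mu0; have [psi [Wpsi Tpsi psi1]] := maximiser mu0.
apply: le_ereal_inf_tmp => _ [Q [f [_ ->]] <-].
have idx_lt (k : 'I_(n - l)) : (l + k < n)%N by rewrite -ltn_subRL; exact: (ltn_ord k).
pose idx k := Ordinal (idx_lt k).
have /choice[rr rrP] : forall k, exists r, lam (idx k) = r%:E.
  by move=> k; apply: finite_eigenvalue; exact: leq_addr.
pose e i := if unlift ord_max i is Some k then phi (idx k) else psi.
pose r i := if unlift ord_max i is Some k then rr k else mu.
have eX i : X (e i) by rewrite /e; case: unliftP => [k|] _ //; exact: Wpsi.1.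
have er i v : X v -> inner (T (e i)) (T v) = (r i)%:C%C * b (e i) v.
  rewrite /e /r; case: unliftP => [k|] _ Xv; first exact: eigen_rel.
  exact: maximiser_eigen.
have [c [i0 ci0] cA] := kernel_nontrivial (fun i j => inner (T (e i)) (f j))
  (ltnSn (n - l)).
pose z := \sum_i c i *: e i.
have Tzf j : inner (T z) (f j) = 0.
  rewrite /z linear_sum (herm_suml inner_hermitian) -[RHS](cA j).
  by apply: eq_bigr => i _; rewrite linearZ (hermZl inner_hermitian).
have Xz : X z by apply: subspace_sum.
have zK k : K k -> inner (T z) (T k) = 0.
  move=> Kk; rewrite /z linear_sum (herm_suml inner_hermitian) big1 // => i _.
  by rewrite linearZ (hermZl inner_hermitian) er ?b_K ?mulr0 //; exact: KX.
have sz : 0 < s z.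
  rewrite lt_neqAle seminorm_ge0 andbT eq_sym; apply/eqP => z0.
  have Kz := K_seminorm0 Xz z0.
  have Tz : T z = 0.
    apply: hnorm_eq0; apply/eqP; rewrite -sqrf_eq0 -qf_inner /qf.
    by rewrite (zK z Kz).
  have {}z0 : z = 0 by apply: T_inj => //; rewrite Tz linear0.
  have zE : \sum_(k < n - l) c (lift ord_max k) *: phi (idx k)
      + c ord_max *: psi = 0.
    rewrite -[RHS]z0 /z big_ord_recr /= /e unlift_none; congr (_ + _).
    apply: eq_bigr => k _; rewrite -[widen_ord _ _]/(widen_ord _ k).
    have -> : widen_ord (leqnSn (n - l)) k = lift ord_max k.
      by apply: val_inj; rewrite /= /bump leqNgt ltn_ord.
    by rewrite liftK.
  have cmax : c ord_max = 0.
    have : b psi (\sum_(k < n - l) c (lift ord_max k) *: phi (idx k)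
        + c ord_max *: psi) = 0 by rewrite zE (herm0r hb).
    rewrite (hermDr hb) (herm_sumr hb) big1 ?add0r => [|k _]; last first.
      by rewrite (hermZr hb) (W_phi _ Wpsi).1 mulr0.
    rewrite (hermZr hb) (herm_diag hb) psi1 mulr1 => /eqP.
    by rewrite conjC_eq0 => /eqP.
  have idxI : injective idx.
    by move=> k k' /(congr1 val) /= /addnI kk; exact: val_inj.
  have [_ ie _ _] := eigen.
  have clift := lin_indep_comp idxI ie (c := fun k => c (lift ord_max k)).
  move: zE; rewrite cmax scale0r addr0 => /clift {}clift.
  move: ci0; case: (unliftP ord_max i0) => [k|] ->.
    by rewrite clift eqxx.
  by rewrite cmax eqxx.
apply: le_ereal_sup_tmp; exists (dist (T z) (span f) / s z)%:E; first by exists z.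
rewrite lee_fin ler_pdivlMr //; apply: le_trans (le_hnorm_dist_ortho Tzf).
rewrite -(@ler_pXn2r _ 2) ?nnegrE ?mulr_ge0 ?sqrtr_ge0 ?hnorm_ge0 //.
rewrite exprMn sqr_sqrtr ?(ltW mu0) // (sqr_seminorm psd).
rewrite /z.
apply: (eigen_family_lower (T := T) (b := b) (e := e) (r := r) (mu := mu) c hb psd) => [i j|i]; first exact: er.
rewrite /r; case: unliftP => [k|] _ //.
exact: (mu_le_eigenvalue Wpsi Tpsi psi1 (rrP k)).
Qed.

(** The approximation [y] is the projection of [z] for [(T ., T .) + b]; the
    residual lies in [W], where [|T x|^2 <= mu b x x] and [mu <= D^2], and its
    energy does not exceed that of [z]. *)
Theorem eigenspace_approximation (D : R) : 0 <= D ->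
  (nwidth (n - l) X0 T b <= D%:E)%E ->
  forall z, X z -> exists2 y, span phi y & hnorm (T z - T y) <= D * s z.
Proof.
move=> D0 widthD z Xz; have [y Sy Wzy] := W_decomposition Xz; exists y => //.
rewrite -linearB -(@ler_pXn2r _ 2) ?nnegrE ?mulr_ge0 ?hnorm_ge0 ?seminorm_ge0 //.
rewrite exprMn (sqr_seminorm psd).
have mu_ge0 : 0 <= mu.
  apply: ub_le_sup; first exact: sphere_has_sup.2.
  exists 0; first by split; [exact: W_subspace.1|rewrite /seminorm_of (herm0l hb) sqrtr0].
  by rewrite linear0 hnorm0 expr0n.
have muD : mu <= D ^+ 2.
  have [mu0|] := ltrP 0 mu; last by move/le_trans; apply; exact: sqr_ge0.
  have := le_trans (mu_le_width mu0) widthD; rewrite lee_fin => H.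
  by rewrite -[leLHS](sqr_sqrtr mu_ge0) ler_pXn2r ?nnegrE ?sqrtr_ge0.
apply: (le_trans (mu_bound Wzy)); apply: ler_pM => //.
have -> : qf b z = qf b (z - y) + qf b y.
  by rewrite -(qfD_ortho hb) ?subrK //; exact: (W_span Wzy Sy).1.
by rewrite lerDl.
Qed.

End Width.

(** * Colored sums and operator norms *)

Lemma sqr_sum_le (R : realDomainType) (m : nat) (a : 'I_m -> R) :
  (\sum_i a i) ^+ 2 <= m%:R * \sum_i a i ^+ 2.
Proof.
suff : 2 * (\sum_i a i) ^+ 2 <= 2 * (m%:R * \sum_i a i ^+ 2).
  by rewrite ler_pM2l.
have -> : 2 * (m%:R * \sum_i a i ^+ 2) = \sum_i \sum_j (a i ^+ 2 + a j ^+ 2).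
  under [RHS]eq_bigr => i _ do rewrite big_split /= sumr_const card_ord.
  rewrite big_split /= sumr_const card_ord sumrMnl.
  by rewrite -mulr2n -!mulrnA mulr_natl mulr_natl mulnC -mulrnA mulnC.
rewrite expr2 mulr_suml mulr_sumr; apply: ler_sum => i _.
rewrite mulr_sumr mulr_sumr; apply: ler_sum => j _.
by have := sqr_ge0 (a i - a j); rewrite sqrrB mulr2n; lra.
Qed.

Lemma hnorm_ortho_sum (R : realType) (U : hilbertType R) (I : finType)
    (p : pred I) (x : I -> U) :
  (forall i j, p i -> p j -> i != j -> inner (x i) (x j) = 0) ->
  hnorm (\sum_(i | p i) x i) ^+ 2 = \sum_(i | p i) hnorm (x i) ^+ 2.
Proof.
move=> xo; apply: complexI.
rewrite -qf_inner -(herm_diag inner_hermitian) (herm_suml inner_hermitian) rmorph_sum /=.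
apply: eq_bigr => i pi; rewrite -qf_inner -(herm_diag inner_hermitian).
rewrite (herm_sumr inner_hermitian) (bigD1 i) //= big1 ?addr0 // => j /andP[pj ji].
by apply: xo => //; rewrite eq_sym.
Qed.

(** Each color class is an orthogonal family, so that the triangle and
    Cauchy-Schwarz inequalities are only needed between classes. *)
Lemma hnorm_colored_sum (R : realType) (U : hilbertType R) (M zeta : nat)
    (color : 'I_M -> 'I_zeta) (x : 'I_M -> U) :
  (forall i j, i != j -> color i = color j -> inner (x i) (x j) = 0) ->
  hnorm (\sum_i x i) ^+ 2 <= zeta%:R * \sum_i hnorm (x i) ^+ 2.
Proof.
move=> xo; pose y k := \sum_(i | color i == k) x i.
have -> : \sum_i x i = \sum_k y k by rewrite (partition_big color predT).
have -> : \sum_i hnorm (x i) ^+ 2 = \sum_k hnorm (y k) ^+ 2.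
  rewrite (partition_big color predT) //=; apply: eq_bigr => k _.
  rewrite hnorm_ortho_sum // => i j /eqP ik /eqP jk ij; apply: xo => //.
  by rewrite ik jk.
apply: le_trans (sqr_sum_le _).
rewrite ler_pXn2r ?nnegrE ?hnorm_ge0 ?sumr_ge0 // => [|k _]; last exact: hnorm_ge0.
apply: (big_ind2 (fun u t => hnorm u <= t)) => //; first by rewrite hnorm0.
by move=> u t u' t' ut ut'; apply: le_trans (ler_hnormD _ _) (lerD ut ut').
Qed.

Lemma hnorm_le_opnorm (R : realType) (U V : hilbertType R) (T : {linear U -> V}) u :
  bounded_map T -> hnorm (T u) <= opnorm T * hnorm u.
Proof.
move=> [C hC]; have [->|u0] := eqVneq u 0; first by rewrite linear0 !hnorm0 mulr0.
have up : 0 < hnorm u.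
  by rewrite lt_neqAle hnorm_ge0 andbT eq_sym; apply: contra_neq u0 => /hnorm_eq0.
have cE : cabs ((hnorm u)^-1)%:C%C = (hnorm u)^-1.
  by rewrite cabs_real // invr_ge0 ltW.
have : hnorm (T (((hnorm u)^-1)%:C%C *: u)) <= opnorm T.
  apply: ub_le_sup; last first.
    by exists (((hnorm u)^-1)%:C%C *: u) => //=; rewrite hnorm_scale cE mulVf ?gt_eqF.
  exists `|C| => _ [v /= v1 <-]; apply: (le_trans (hC v)).
  apply: (@le_trans _ _ (`|C| * hnorm v)).
    by rewrite ler_wpM2r ?hnorm_ge0 ?ler_norm.
  by rewrite -[leRHS]mulr1 ler_wpM2l.
by rewrite linearZ hnorm_scale /= cE mulrC ler_pdivrMr.
Qed.

(** * Local and global approximation *)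

Section Approximation.
Context {R : realType} {d : nat} {Om : set 'rV[R]_d}.
Variable X : local_spaces Om.
Hypothesis Om_sub : subdomain Om Om.

Lemma hnorm_zext (D : set 'rV[R]_d) (v : sH0 X D) : subdomain Om D ->
  hnorm (zext v) = hnorm v.
Proof. by move=> sD; rewrite /zext inc_isom ext_isom //; have [] := sD. Qed.

Lemma HB_subspace D : subspace (HB X D).
Proof.
split=> [v|a u v Hu Hv t]; first by rewrite linear0l.
by rewrite linearPl Hu Hv /= mulr0 addr0.
Qed.

Lemma HB_closed D (u : nat -> sH X D) l : subdomain Om D ->
  (forall k, HB X D (u k)) ->
  (forall e : R, 0 < e -> exists N : nat, forall k, (N <= k)%N ->
     hnorm (u k - l) < e) -> HB X D l.
Proof.
move=> sD uH ul v; have [C hC] := form_bounded X sD.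
apply: cabs_eq0; apply/eqP; rewrite eq_le cabs_ge0 andbT.
apply: le_of_forall_ltD => e e0; rewrite add0r.
set c := `|C| * hnorm (inc X D v); have c0 : 0 <= c by rewrite mulr_ge0 ?hnorm_ge0.
have [|N /(_ N (leqnn N)) NP] := ul (e / (c + 1)).
  by rewrite divr_gt0 // ltr_wpDl.
have -> : form X D l (inc X D v) = - form X D (u N - l) (inc X D v).
  by rewrite linearBl (uH N v) /= sub0r opprK.
rewrite /cabs normrN -/(cabs _); apply: (le_lt_trans (hC _ _)).
move: NP; rewrite ltr_pdivlMr ?ltr_wpDl //; apply: le_lt_trans.
apply: (@le_trans _ _ (hnorm (u N - l) * c)).
  rewrite /c mulrA [hnorm _ * _]mulrC !ler_wpM2r ?hnorm_ge0 //.
  exact: ler_norm.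
by rewrite ler_wpM2l ?hnorm_ge0 // lerDl.
Qed.

Variables (M : nat) (w ws : 'I_M -> set 'rV[R]_d).
Hypothesis cover : oversampled_cover Om w ws.
Variable P : forall i, {linear sH X (w i) -> sH0 X (w i)}.
Hypothesis pou : partition_of_unity X P.
Variables (Bp : forall i, {hermitian_sym (sH X (ws i)) for (@Num.conj R[i])}).
Variables (K : forall i, set (sH X (ws i))) (l n : 'I_M -> nat).
Arguments Bp : clear implicits.
Arguments K : clear implicits.
Hypotheses (hBp : semi_inner_products X Bp K l) (hPhat : Phat_assumption X P K).
Hypothesis ln : forall i, (l i < n i)%N.
Variables (lam : forall i, 'I_(n i) -> \bar R) (phi : forall i, 'I_(n i) -> sH X (ws i)).
Arguments phi : clear implicits.
Arguments lam : clear implicits.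
Hypothesis hphi : local_eigenpairs X P Bp K lam phi.

Let w_sub i : subdomain Om (w i). Proof. by have [] := cover. Qed.
Let ws_sub i : subdomain Om (ws i). Proof. by have [] := cover. Qed.
Let w_ws i : w i `<=` ws i. Proof. by have [] := cover. Qed.
Let ws_Om i : ws i `<=` Om. Proof. by have [] := ws_sub i. Qed.

Lemma Bp_psd i u : 0 <= qf (Bp i) u.
Proof.
have [[_ /(_ u) pos] _ _ _] := hBp i.
by rewrite -lecR -(herm_diag (hermitian_sym_fun (Bp i))).
Qed.

Let That i : {linear sH X (ws i) -> sH0 X (w i)} := P i \o res X (ws i) (w i).

Let That_bounded i : bounded_map (That i).
Proof.
have [C hC] := pou.1 i; exists `|C| => u.
apply: (le_trans (hC _)); apply: (@le_trans _ _ (`|C| * hnorm (res X (ws i) (w i) u))).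
  by rewrite ler_wpM2r ?hnorm_ge0 ?ler_norm.
by rewrite ler_wpM2l // res_le.
Qed.

Lemma local_approximation (D : R) : 0 <= D ->
  (dmax X P Bp K l n <= D%:E)%E ->
  forall i z, HB X (ws i) z -> exists2 y, span (phi i) y &
    hnorm (Phat P z - Phat P y) <= D * seminorm_of (Bp i) z.
Proof.
move=> D0 hD i z Hz.
have [[bB _] [Kdim KH] Krad compl] := hBp i; have [Tinj Tcomp] := hPhat i.
apply: (@eigenspace_approximation _ _ _ (That i) (HB X (ws i)) (K i) (Bp i)
  (HB_subspace _) (hermitian_sym_fun _) (Bp_psd (i := i))
  (fun u y => HB_closed (ws_sub i)) bB compl (l i) (n i) Kdim KH Krad Tinj
  (That_bounded i) Tcomp (lam i) (phi i) (ln i) (hphi i) D D0 _ z Hz).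
by apply: le_trans hD; exact: (le_bigmax _ (fun i => nwidth _ _ _ _) i).
Qed.

Lemma Phat0_le i v : hnorm (Phat0 P v) <= Pmax X ws P * hnorm (v : sH0 X (ws i)).
Proof.
pose T : {linear sH0 X (ws i) -> sH0 X (w i)} := That i \o inc X (ws i).
have bT : bounded_map T.
  have [C hC] := That_bounded i; have [C' hC'] := inc_bounded X (ws_sub i).
  exists (`|C| * C') => u; apply: (le_trans (hC _)); rewrite -mulrA.
  apply: (@le_trans _ _ (`|C| * hnorm (inc X (ws i) u))).
    by rewrite ler_wpM2r ?hnorm_ge0 ?ler_norm.
  exact: ler_wpM2l.
apply: (le_trans (hnorm_le_opnorm v bT)); rewrite ler_wpM2r ?hnorm_ge0 //.
exact: (le_bigmax _ (fun i => opnorm (@Phat0 _ _ _ X M w ws P i)) i).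
Qed.

Variables (zeta zetas : nat).
Hypotheses (hzeta : coloring_constant X w zeta) (hzetas : overlap_bound Bp zetas).

(** The overlap inequality, applied to the zero extension of [v]. *)
Lemma seminorm_inc_le i (v : sH0 X (ws i)) :
  seminorm_of (Bp i) (inc X (ws i) v) <= Num.sqrt zetas%:R * hnorm v.
Proof.
rewrite -(@ler_pXn2r _ 2) ?nnegrE ?mulr_ge0 ?sqrtr_ge0 ?hnorm_ge0 //.
rewrite exprMn (sqr_sqrtr (ler0n _ _)) -(hnorm_zext v (ws_sub i)).
have [_ _ /(_ (zext v))] := hzetas; apply: le_trans.
rewrite (bigD1 i) //= /zext res_ext // lerDl sumr_ge0 // => j _.
exact: sqr_ge0.
Qed.

Variables (C1 C0 Cs Cstab : R).
Hypotheses (C1_gt0 : 0 < C1) (Cs_gt0 : 0 < Cs).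
Hypotheses (hlocal : local_stability X ws C1 C0 Cs)
  (Hsmall : Hmax ws <= Num.sqrt (C1 / C0) * Cs^-1).

(** Locally a solution is the sum of a local solution with the same right-hand
    side, which is small because the subdomains are, and of a function in
    [HB], which the eigenvectors approximate. *)
Lemma local_error (D : R) g u i : 0 <= D -> (dmax X P Bp K l n <= D%:E)%E ->
  primal_solution g u ->
  exists2 y, span (phi i) y &
    hnorm (P i (res X Om (w i) u) - P i (res X (ws i) (w i) y)) <=
      (Pmax X ws P + D * Num.sqrt zetas%:R) *
        (Cs * Hmax ws / C1 * hnorm (resL X Om (ws i) g))
      + D * seminorm_of (Bp i) (res X Om (ws i) u).
Proof.
move=> D0 hD gu.
have [[u0 [u0sol _]] u0stab] := hlocal Hsmall (resL X Om (ws i) g).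
have {}u0stab := u0stab _ u0sol.
set z := res X Om (ws i) u - inc X (ws i) u0.
have Hz : HB X (ws i) z.
  move=> v; rewrite /z linearBl u0sol /= form_res //.
  by rewrite -[form X Om]/(B X) gu -inner_res // subrr.
have [y Sy yz] := local_approximation D0 hD Hz; exists y => //.
have -> : P i (res X Om (w i) u) - P i (res X (ws i) (w i) y) =
    Phat0 P u0 + (Phat P z - Phat P y).
  rewrite /Phat0 /Phat /z -(res_res (w_sub i) (ws_sub i) Om_sub (@w_ws i) (@ws_Om i)).
  by rewrite addrA; congr (_ - _); rewrite [res X (ws i) (w i) (_ - _)]linearB linearB addrC subrK.
have zle : seminorm_of (Bp i) z <=
    seminorm_of (Bp i) (res X Om (ws i) u) + Num.sqrt zetas%:R * hnorm u0.
  apply: (le_trans (seminormD (hermitian_sym_fun _) (Bp_psd (i := i)) _ _)).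
  by rewrite (seminormN (hermitian_sym_fun _)) lerD2l seminorm_inc_le.
have P0 : 0 <= Pmax X ws P.
  by apply: bigmax_ge_id.
apply: (le_trans (ler_hnormD _ _)); apply: (le_trans (lerD (Phat0_le u0) yz)).
have h1 : D * seminorm_of (Bp i) z <= D * (seminorm_of (Bp i) (res X Om (ws i) u)
    + Num.sqrt zetas%:R * hnorm u0) by rewrite ler_wpM2l.
have h2 : (Pmax X ws P + D * Num.sqrt zetas%:R) * hnorm u0 <=
  (Pmax X ws P + D * Num.sqrt zetas%:R) *
    (Cs * Hmax ws / C1 * hnorm (resL X Om (ws i) g)).
  by rewrite ler_wpM2l // addr_ge0 // mulr_ge0 ?sqrtr_ge0.
lra.
Qed.

(** In the local error [Pmax] times the local solution contributes [x / 2], and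
    its energy, weighted by [D], at most [x / 8] because [D zetas^(1/2) <= 1 / 4];
    the energy of [u] contributes [x / 4] in the sum over the domains. *)
Theorem gfem_approximation (D x : R) g u : 0 <= D -> 0 <= x ->
  (dmax X P Bp K l n <= D%:E)%E ->
  1 <= Pmax X ws P -> Pmax X ws P * (Cs * Hmax ws / C1) <= x / 2 ->
  D * Num.sqrt zetas%:R <= 4^-1 -> D * Cstab <= x / 4 ->
  primal_solution g u -> hnorm u <= Cstab * hnorm g ->
  exists2 v, Sn X P phi v &
    hnorm (u - v) <= Num.sqrt (zeta%:R * zetas%:R) * x * hnorm g.
Proof.
move=> D0 x0 hD P1 Px Dz Dx gu ustab.
pose y i := s2val (cid2 (local_error i D0 hD gu)).
have yS i : span (phi i) (y i) := s2valP (cid2 (local_error i D0 hD gu)).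
have yP i := s2valP' (cid2 (local_error i D0 hD gu)); rewrite -/(y _) in yP.
exists (\sum_i zext (P i (res X (ws i) (w i) (y i)))).
  exists (fun i => res X (ws i) (w i) (y i)) => // i.
  have [c _ <-] := yS i; exists c => //.
  by rewrite linear_sum; apply: eq_bigr => j _; rewrite linearZ.
have [color hcolor] := hzeta.
pose e i := P i (res X Om (w i) u) - P i (res X (ws i) (w i) (y i)).
have -> : u - \sum_i zext (P i (res X (ws i) (w i) (y i))) = \sum_i zext (e i).
  rewrite {1}(pou.2 u) -sumrB; apply: eq_bigr => i _.
  by rewrite /zext /e !linearB.
have q0 : 0 <= Cs * Hmax ws / C1.
  rewrite divr_ge0 ?(ltW C1_gt0) // mulr_ge0 ?(ltW Cs_gt0) //.
  by rewrite /Hmax bigmax_ge_id.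
have e_le i : hnorm (e i) <= 5 / 8 * x * hnorm (resL X Om (ws i) g)
    + D * seminorm_of (Bp i) (res X Om (ws i) u).
  apply: (le_trans (yP i)); rewrite lerD2r mulrA ler_wpM2r ?hnorm_ge0 //.
  set q := Cs * _ / _ in q0 Px *.
  have h1 : D * Num.sqrt zetas%:R * q <= 4^-1 * q by rewrite ler_wpM2r.
  have h2 : 1 * q <= Pmax X ws P * q by rewrite ler_wpM2r.
  lra.
have e_sqr i : hnorm (e i) ^+ 2 <=
    25 / 32 * x ^+ 2 * hnorm (resL X Om (ws i) g) ^+ 2
    + 2 * D ^+ 2 * seminorm_of (Bp i) (res X Om (ws i) u) ^+ 2.
  set a := 5 / 8 * x * hnorm (resL X Om (ws i) g).
  set c := D * seminorm_of (Bp i) (res X Om (ws i) u).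
  have ac : hnorm (e i) ^+ 2 <= (a + c) ^+ 2.
    rewrite ler_pXn2r ?nnegrE ?hnorm_ge0 ?e_le //.
    by rewrite addr_ge0 // !mulr_ge0 ?hnorm_ge0 ?sqrtr_ge0.
  apply: (le_trans ac); have := sqr_ge0 (a - c).
  rewrite sqrrB sqrrD !mulr2n => h.
  have -> : 25 / 32 * x ^+ 2 * hnorm (resL X Om (ws i) g) ^+ 2
    + 2 * D ^+ 2 * seminorm_of (Bp i) (res X Om (ws i) u) ^+ 2
    = 2 * a ^+ 2 + 2 * c ^+ 2 by rewrite /a /c; field.
  lra.
have [_ hL hB] := hzetas.
rewrite -(@ler_pXn2r _ 2) ?nnegrE ?hnorm_ge0 //; last first.
  by rewrite !mulr_ge0 ?hnorm_ge0 ?sqrtr_ge0.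
apply: (@le_trans _ _ (zeta%:R * \sum_i hnorm (zext (e i)) ^+ 2)).
  by apply: (hnorm_colored_sum (color := color)) => i j ij cij; exact: hcolor.
rewrite !exprMn sqr_sqrtr ?mulr_ge0 //.
rewrite -2!(mulrA zeta%:R); apply: ler_wpM2l => //.
under eq_bigr => i _ do rewrite hnorm_zext //.
apply: (le_trans (ler_sum _ (fun i _ => e_sqr i))).
rewrite big_split /= -!mulr_sumr.
have h1 : 25 / 32 * x ^+ 2 * \sum_i hnorm (resL X Om (ws i) g) ^+ 2 <=
    25 / 32 * x ^+ 2 * (zetas%:R * hnorm g ^+ 2).
  by rewrite ler_wpM2l // mulr_ge0 ?sqr_ge0 // divr_ge0.
have h2 : 2 * D ^+ 2 * \sum_i seminorm_of (Bp i) (res X Om (ws i) u) ^+ 2 <=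
    2 * D ^+ 2 * (zetas%:R * hnorm u ^+ 2).
  by rewrite ler_wpM2l // mulr_ge0 ?sqr_ge0.
have h3 : (D * hnorm u) ^+ 2 <= (x / 4 * hnorm g) ^+ 2.
  rewrite ler_pXn2r ?nnegrE ?mulr_ge0 ?hnorm_ge0 ?invr_ge0 //.
  apply: (@le_trans _ _ (D * (Cstab * hnorm g))); first by rewrite ler_wpM2l.
  by rewrite mulrA ler_wpM2r ?hnorm_ge0.
have h4 : 2 * zetas%:R * (D * hnorm u) ^+ 2 <= 2 * zetas%:R * (x / 4 * hnorm g) ^+ 2.
  by rewrite ler_wpM2l // mulr_ge0.
have h5 : 0 <= zetas%:R * x ^+ 2 * hnorm g ^+ 2.
  by rewrite mulr_ge0 ?sqr_ge0 // mulr_ge0 ?sqr_ge0.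
apply: (le_trans (lerD h1 h2)).
have -> : 2 * D ^+ 2 * (zetas%:R * hnorm u ^+ 2) = 2 * zetas%:R * (D * hnorm u) ^+ 2.
  by ring.
apply: (le_trans (lerD (lexx _) h4)).
have -> : 2 * zetas%:R * (x / 4 * hnorm g) ^+ 2 =
   8^-1 * (zetas%:R * x ^+ 2 * hnorm g ^+ 2) by field.
have -> : 25 / 32 * x ^+ 2 * (zetas%:R * hnorm g ^+ 2) =
  25 / 32 * (zetas%:R * x ^+ 2 * hnorm g ^+ 2) by ring.
move: h5; set A := _ * _ * hnorm g ^+ 2; lra.
Qed.

End Approximation.

(** * Duality and quasi-optimality *)

Section Duality.
Context {R : realType} {d : nat} {Om : set 'rV[R]_d}.
Variable X : local_spaces Om.

Lemma adjoint_solution_exists (f : sL X Om) : unique_solvability X ->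
  exists z, adjoint_solution f z.
Proof.
move=> [_ solv].
have [C hC] := emb_bounded X.
have [|z [zP _]] := solv (applyr inner f \o emb X Om); last by exists z.
exists (`|C| * hnorm f) => v /=.
apply: (le_trans (inner_CS _ _)); rewrite mulrAC ler_wpM2r ?hnorm_ge0 //.
apply: (le_trans (hC v)); by rewrite ler_wpM2r ?hnorm_ge0 ?ler_norm.
Qed.

(** By duality the solution operators of the primal and of the adjoint problem
    have the same norm on [L(Om)], and the adjoint assumption bounds the second
    norm by [Cad] times the first. For [Cad < 1] both vanish; the induction
    improves an initial bound by a factor [Cad] in each step. *)
Lemma adjoint_constant_lt1
    (cj : {linear (sH X Om) -> (sH X Om) | (@Num.conj R[i]) \; *:%R})
    (Cad Cstab Castab : R) :
  unique_solvability X -> stability X Cstab Castab -> is_conjugation cj ->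
  adjoint_assumption cj Cad -> 0 <= Cad < 1 ->
  forall g u, primal_solution g u -> emb X Om u = 0.
Proof.
move=> solv stab [_ _ cjL] adj Cad01 g u gu; apply: hnorm_eq0.
have Cad0 : 0 <= Cad by case/andP: Cad01.
have [C hC] := emb_bounded X.
set t0 := `|C| * `|Cstab|.
have iterate k : forall g u, primal_solution g u ->
    hnorm (emb X Om u) <= t0 * Cad ^+ k * hnorm g.
  elim: k => [|k IH] {g gu}g {u}u gu.
    rewrite expr0 mulr1 /t0; apply: (le_trans (hC u)).
    have [/(_ u gu) us _] := stab g.
    rewrite -mulrA; apply: (@le_trans _ _ (`|C| * hnorm u)).
      by rewrite ler_wpM2r ?hnorm_ge0 ?ler_norm.
    rewrite ler_wpM2l //; apply: (le_trans us).
    by rewrite ler_wpM2r ?hnorm_ge0 ?ler_norm.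
  set f := emb X Om u.
  have [z zf] := adjoint_solution_exists f solv.
  have [g' g'z g'f] := adj f z zf.
  have zle : hnorm (emb X Om z) <= t0 * Cad ^+ k * hnorm g'.
    by case: g'z => [/IH //|/IH]; rewrite cjL.
  have [f0|f0] := eqVneq (hnorm f) 0.
    by rewrite f0 !mulr_ge0 ?hnorm_ge0 ?exprn_ge0.
  have fp : 0 < hnorm f by rewrite lt_neqAle eq_sym f0 hnorm_ge0.
  rewrite -(ler_pM2l fp) -expr2 -qf_inner /qf -[X in inner X]/(emb X Om u) -zf gu.
  apply: (le_trans (le_Re_cabs _)); apply: (le_trans (inner_CS _ _)).
  have -> : hnorm f * (t0 * Cad ^+ k.+1 * hnorm g) =
      hnorm g * (t0 * Cad ^+ k * (Cad * hnorm f)) by rewrite exprSr; ring.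
  rewrite ler_wpM2l ?hnorm_ge0 //; apply: (le_trans zle).
  by rewrite ler_wpM2l // mulr_ge0 ?exprn_ge0 // mulr_ge0.
apply/eqP; rewrite eq_le hnorm_ge0 andbT.
apply: le_of_forall_ltD => e e0; rewrite add0r.
have [N NP] := geometric_small (t0 * hnorm g) Cad01 e0.
apply: le_lt_trans (NP N (leqnn N)); apply: (le_trans (iterate N g u gu)).
by rewrite mulrAC.
Qed.

End Duality.

Theorem corollary3p27 (R : realType) (d : nat) (hd : d = 2%N \/ d = 3%N)
    (Om : set 'rV[R]_d) (hOm : bounded_lipschitz_domain Om)
    (X : local_spaces Om)
    (* constants and well-posedness of the global problem *)
    (Cb C1 C0 Cstab Castab : R)
    (hCb : 0 < Cb) (hC1 : 0 < C1) (hC0 : 0 < C0)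
    (hCstab : 0 < Cstab) (hCastab : 0 < Castab)
    (hcont : continuity X Cb) (hgarding : garding X C1 C0)
    (hC1Cb : C1 <= 2 * Cb)
    (hsolv : unique_solvability X) (hstab : stability X Cstab Castab)
    (* cover and partition of unity *)
    (M : nat) (w ws : 'I_M -> set 'rV[R]_d)
    (hcover : oversampled_cover Om w ws)
    (P : forall i, {linear sH X (w i) -> sH0 X (w i)})
    (hP : partition_of_unity X P)
    (* data and local particular functions *)
    (F : {antifunctional (sH X Om)}) (hF : bounded_functional F)
    (psi : forall i, sH X (ws i)) (hpsi : local_particular X ws F psi)
    (* semi-inner products *)
    (Bp : forall i, {hermitian_sym (sH X (ws i)) for (@Num.conj R[i])})
    (K : forall i, set (sH X (ws i))) (l : 'I_M -> nat)
    (hBp : semi_inner_products X Bp K l) (hPhat : Phat_assumption X P K)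
    (* local approximation spaces *)
    (n : 'I_M -> nat) (hn : forall i, (l i < n i)%N)
    (lam : forall i, 'I_(n i) -> \bar R)
    (phi : forall i, 'I_(n i) -> sH X (ws i))
    (hphi : local_eigenpairs X P Bp K lam phi)
    (* coloring and overlap constants *)
    (zeta zetas : nat) (hzeta : coloring_constant X w zeta)
    (hzetas : overlap_constant X Bp zetas)
    (* adjoint and local stability assumptions *)
    (cj : {linear (sH X Om) -> (sH X Om) | (@Num.conj R[i]) \; *:%R})
    (hcj : is_conjugation cj)
    (Cad : R) (hCad : 0 < Cad) (hadj : adjoint_assumption cj Cad)
    (hSn : adjoint_is_primal X Cad \/
           forall v, Sn X P phi v -> Sn X P phi (cj v))
    (Cs : R) (hCs : 0 < Cs) (hlocal : local_stability X ws C1 C0 Cs)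
    (* exact solution and GFEM approximation *)
    (ue uG : sH X Om)
    (hue : forall v, B X ue v = F v)
    (huG : Sn X P phi (uG - uparticular X P psi))
    (hgalerkin : forall v, Sn X P phi v -> B X uG v = F v)
    (* smallness conditions *)
    (hd1 : (dmax X P Bp K l n <= 1)%E) (hP1 : 1 <= Pmax X ws P)
    (hdmax : (dmax X P Bp K l n <=
       ((4 * Num.sqrt 2 * Cstab)^-1 * Xi zeta zetas Cad C1 C0 Cb)%:E)%E)
    (hHmax : Hmax ws <=
       C1 * (2 * Cs * Pmax X ws P)^-1 * Xi zeta zetas Cad C1 C0 Cb) :
  hnorm (ue - uG) <=
    2 * Cb / C1 *
      inf [set hnorm (ue - v) | v in [set v | Sn X P phi (v - uparticular X P psi)]].
Proof.
have Om_dom : is_domain Om by have [] := hOm.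
have Om_sub : subdomain Om Om by split.
set e := ue - uG.
have e_ortho v : Sn X P phi v -> B X e v = 0.
  by move=> Sv; rewrite /e linearBl hue hgalerkin // subrr.
have Sn_sub : forall u v, Sn X P phi u -> Sn X P phi v -> Sn X P phi (u - v).
  move=> _ _ [f Sf ->] [f' Sf' ->]; exists (fun i => f i - f' i).
    by move=> i; apply: subspaceB (Sf i) (Sf' i); exact: span_subspace.
  by rewrite -sumrB; apply: eq_bigr => i _; rewrite /zext !linearB.
(* It suffices to dominate the lower-order term of the Garding inequality. *)
suff absorb : C0 * hnorm (emb X Om e) ^+ 2 <= C1 / 2 * hnorm e ^+ 2.
  have k0 : 0 < 2 * Cb / C1 by rewrite divr_gt0 // mulr_gt0.
  rewrite mulrC -ler_pdivrMr //; apply: lb_le_inf.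
    exists (hnorm (ue - uG)), uG => //.
  move=> _ [v Sv <-]; rewrite ler_pdivrMr //.
  have [e0|e0] := eqVneq (hnorm e) 0.
    by rewrite -/e e0 mulr_ge0 ?hnorm_ge0 ?(ltW k0).
  have ep : 0 < hnorm e by rewrite lt_neqAle eq_sym e0 hnorm_ge0.
  have Bee : B X e e = B X e (ue - v).
    apply/eqP; rewrite -subr_eq0 -linearBr /e.
    have -> : ue - uG - (ue - v) =
        (v - uparticular X P psi) - (uG - uparticular X P psi).
      by rewrite !opprB addrC !subrKA.
    by rewrite e_ortho //; exact: Sn_sub.
  have := hgarding e; have := hcont e (ue - v); rewrite -Bee => h1 h2.
  have h3 : C1 / 2 * hnorm e * hnorm e <= Cb * hnorm (ue - v) * hnorm e.
    move: h1 h2 absorb; rewrite !expr2; lra.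
  move: h3; rewrite ler_pM2r // -/e => h3.
  have -> : hnorm (ue - v) * (2 * Cb / C1) = Cb * hnorm (ue - v) / (C1 / 2).
    by field; rewrite gt_eqF.
  by rewrite ler_pdivlMr ?divr_gt0 // mulrC.
rewrite leNgt; apply/negP => large.
set rho := hnorm (emb X Om e) in large.
have rho0 : 0 < rho.
  rewrite lt_neqAle hnorm_ge0 andbT eq_sym; apply/eqP => r0.
  move: large; rewrite r0 expr0n mulr0 ltNge mulr_ge0 ?sqr_ge0 //.
  by rewrite divr_ge0 ?(ltW hC1).
have [z zP] := adjoint_solution_exists (emb X Om e) hsolv.
have Bez : (B X e z) = (rho ^+ 2)%:C%C.
  by rewrite zP (herm_diag inner_hermitian) qf_inner.
have rho_le (v : sH X Om) : Sn X P phi v -> rho ^+ 2 <= Cb * hnorm e * hnorm (z - v).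
  move=> Sv; apply: le_trans (hcont e (z - v)).
  by rewrite linearBr (e_ortho v Sv) subr0 Bez cabs_real ?sqr_ge0.
have [cjK cjH cjL] := hcj.
(* The function that is approximated, [z] or its conjugate. *)
have [g [zh [zhP gle zhH zhSn]]] : exists g zh, [/\ primal_solution g zh,
    hnorm g <= Cad * rho, hnorm zh = hnorm z &
    forall v, Sn X P phi v -> exists2 v', Sn X P phi v' &
      hnorm (z - v') = hnorm (zh - v)].
  case: hSn => [prim|Sn_cj].
    have [g gz gle] := prim _ _ zP; exists g, z; split=> // v Sv; by exists v.
  have [g [gz|gz] gle] := hadj _ _ zP.
    by exists g, z; split=> // v Sv; exists v.
  exists g, (cj z); split=> // v Sv; exists (cj v); first exact: Sn_cj.
  by rewrite -[in RHS](cjK v) -linearB cjH.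
(* Otherwise [z] would vanish, although [B e z = rho ^+ 2]. *)
have Cad1 : 1 <= Cad.
  rewrite leNgt; apply/negP => Cad1.
  have Cad01 : 0 <= Cad < 1 by rewrite Cad1 ltW.
  have van := adjoint_constant_lt1 hsolv hstab hcj hadj Cad01.
  have [g' [gz|gz] _] := hadj _ _ zP.
    have z0 := van _ _ gz.
    have zz : z = 0 by apply: (emb_inj Om_sub); rewrite z0 linear0.
    move/eqP: Bez; rewrite zz linear0r eq_sym; apply/negP.
    by rewrite fmorph_eq0 expf_eq0 /= gt_eqF.
  have z0 := van _ _ gz.
  have zz : z = 0.
    apply: (emb_inj Om_sub); rewrite linear0.
    by apply: hnorm_eq0; rewrite -cjL z0 hnorm0.
  move/eqP: Bez; rewrite zz linear0r eq_sym; apply/negP.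
  by rewrite fmorph_eq0 expf_eq0 /= gt_eqF.
have [[zetas0 hL hB] _] := hzetas.
have zeta0 : (0 < zeta)%N.
  have [color _] := hzeta.
  have [M0|M0] := posnP M; last first.
    exact: leq_ltn_trans (ltn_ord (color (Ordinal M0))).
  have := hP1; rewrite /Pmax big_pred0 ?ler10 // => i.
  by have := ltn_ord i; rewrite [X in (_ < X)%N]M0.
set x := Xi zeta zetas Cad C1 C0 Cb.
set Z := Num.sqrt (zeta%:R * zetas%:R : R).
set Y := Num.sqrt (C1 / (2 * C0 * Cb ^+ 2)).
have Z1 : 1 <= Z.
  by rewrite -[leLHS]sqrtr1 ler_sqrt ?mulr_ge0 // mulr_ege1 // ler1n.
have zetasZ : Num.sqrt (zetas%:R : R) <= Z.
  by rewrite ler_sqrt ?mulr_ge0 // ler_peMl // ler1n.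
have Y0 : 0 <= Y by exact: sqrtr_ge0.
have ZC : 0 < Z * Cad by rewrite mulr_gt0 // (lt_le_trans ltr01).
have xE : Z * Cad * x = Y by rewrite /x /Xi mulVKf ?gt_eqF.
have x0 : 0 <= x by rewrite /x /Xi mulr_ge0 // invr_ge0 ltW.
have Y2 : C0 * (Cb * Y) ^+ 2 = C1 / 2.
  rewrite exprMn sqr_sqrtr; first by field; rewrite !gt_eqF.
  by rewrite divr_ge0 ?(ltW hC1) // mulr_ge0 ?sqr_ge0 // mulr_ge0 // ltW.
have eY : Cb * Y * hnorm e < rho.
  rewrite -(@ltr_pXn2r _ 2) ?nnegrE ?mulr_ge0 ?hnorm_ge0 ?(ltW hCb) //.
  by rewrite exprMn -(ltr_pM2l hC0) mulrA Y2.
(* Since [e] is small in the norm of [H] compared with [rho], the identity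
   [B e z = rho ^+ 2] forces [z] to be large. *)
have ZxCstab : Z * x <= Cstab.
  have [/(_ zh zhP) zh_stab _] := hstab g.
  have zle : hnorm z <= Cstab * (Cad * rho).
    by rewrite -zhH; apply: (le_trans zh_stab); rewrite ler_wpM2l // ltW.
  have := rho_le 0; rewrite subr0 => /(_ _) h1.
  have Sn0 : Sn X P phi 0 by rewrite -(subrr (uG - uparticular X P psi)); exact: Sn_sub.
  have {}h1 := h1 Sn0.
  have h2 : rho <= Cb * hnorm e * (Cstab * Cad).
    rewrite -(ler_pM2r rho0) -expr2 (le_trans h1) // -!mulrA.
    rewrite ler_wpM2l ?(ltW hCb) // ler_wpM2l ?hnorm_ge0 //.
  have h3 := lt_le_trans eY h2.
  have ep : 0 < hnorm e.
    rewrite lt_neqAle hnorm_ge0 andbT eq_sym; apply/eqP => e0.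
    by move: h3; rewrite e0 !mulr0 mul0r ltxx.
  have h4 : (Cb * hnorm e) * Y < (Cb * hnorm e) * (Cstab * Cad) by lra.
  rewrite ltr_pM2l ?mulr_gt0 // -xE in h4.
  rewrite -(ler_pM2r hCad); lra.
have s2 : 1 <= Num.sqrt (2 : R) by rewrite -[leLHS]sqrtr1 ler_sqrt // ler1n.
set D := (4 * Num.sqrt 2 * Cstab)^-1 * x in hdmax.
have D0 : 0 <= D by rewrite mulr_ge0 // invr_ge0 !mulr_ge0 // ltW.
have DC : D * Cstab <= x / 4.
  have -> : D * Cstab = (x / 4) * (Num.sqrt 2)^-1.
    by rewrite /D; field; rewrite !gt_eqF // (lt_le_trans ltr01).
  rewrite -[leRHS]mulr1 ler_wpM2l ?divr_ge0 //.
  by rewrite invf_le1 // (lt_le_trans ltr01).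
have Dz : D * Num.sqrt zetas%:R <= 4^-1.
  rewrite -(ler_pM2r hCstab).
  have h1 : D * Cstab * Num.sqrt zetas%:R <= x / 4 * Num.sqrt zetas%:R.
    by rewrite ler_wpM2r ?sqrtr_ge0.
  have h2 : x * Num.sqrt zetas%:R <= x * Z by rewrite ler_wpM2l.
  lra.
set Pm := Pmax X ws P in hP1 hHmax.
have Pm0 : 0 < Pm by exact: lt_le_trans ltr01 _.
have Px : Pm * (Cs * Hmax ws / C1) <= x / 2.
  have -> : Pm * (Cs * Hmax ws / C1) = (Pm * Cs / C1) * Hmax ws.
    by field; rewrite gt_eqF.
  have -> : x / 2 = (Pm * Cs / C1) * (C1 * (2 * Cs * Pm)^-1 * x).
    by field; rewrite !gt_eqF.
  by rewrite ler_wpM2l // divr_ge0 ?mulr_ge0 // ltW.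
have Hsmall : Hmax ws <= Num.sqrt (C1 / C0) * Cs^-1.
  rewrite ler_pdivlMr //.
  have h1 : Cs * Hmax ws / C1 <= x / 2.
    apply: le_trans Px; rewrite ler_peMl // divr_ge0 ?(ltW hC1) //.
    by rewrite mulr_ge0 ?(ltW hCs) // /Hmax bigmax_ge_id.
  rewrite ler_pdivrMr // in h1.
  have h2 : x <= Y.
    rewrite -xE ler_peMl // mulr_ege1 //.
  have h3 : x * C1 <= Y * (2 * Cb) by rewrite ler_pM // ltW.
  have h4 : Cb * Y <= Num.sqrt (C1 / C0).
    rewrite -(@ler_pXn2r _ 2) ?nnegrE ?sqrtr_ge0 ?mulr_ge0 ?(ltW hCb) //.
    rewrite sqr_sqrtr ?divr_ge0 ?(ltW hC1) ?(ltW hC0) //.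
    rewrite ler_pdivlMr // mulrC Y2; lra.
  rewrite mulrC; lra.
have [/(_ zh zhP) zh_stab _] := hstab g.
have [v Sv vzh] := gfem_approximation Om_sub hcover hP hBp hPhat hn hphi hzeta
  (And3 zetas0 hL hB) hC1 hCs hlocal Hsmall D0 x0 hdmax hP1 Px Dz DC
  zhP zh_stab.
have [v' Sv' v'z] := zhSn v Sv.
have := rho_le v' Sv'; rewrite v'z => h1.
have h2 : hnorm (zh - v) <= Y * rho.
  rewrite -xE; apply: (le_trans vzh).
  have -> : Z * Cad * x * rho = Z * x * (Cad * rho) by ring.
  by rewrite ler_wpM2l // mulr_ge0 // (le_trans ler01).
have h3 : Cb * hnorm e * hnorm (zh - v) <= Cb * hnorm e * (Y * rho).
  by rewrite ler_wpM2l // mulr_ge0 ?hnorm_ge0 ?(ltW hCb).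
have := le_trans h1 h3; rewrite expr2.
have -> : Cb * hnorm e * (Y * rho) = Cb * Y * hnorm e * rho by ring.
by rewrite ler_pM2r // leNgt eY.
Qed.
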